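(* Let $\mathcal T$ be a balanced CStree on the variables $X_1,\dots,X_p$, with set of minimal contexts $\mathcal C_{\mathcal T}$ and minimal context DAGs $G_{X_C=\mathbf x_C}$, $(X_C=\mathbf x_C)\in\mathcal C_{\mathcal T}$. Then the family of directed moralizations $\big((G_{X_C=\mathbf x_C})^{dm}\big)_{(X_C=\mathbf x_C)\in\mathcal C_{\mathcal T}}$ implies exactly the same CSI statements as the model $\mathcal M(\mathcal T)$. In particular, one can apply the directed moralization operation until all context DAGs are perfect: the DAGs $(G_{X_C=\mathbf x_C})^{\mathrm{per}}$, obtained by applying directed moralization $\binom p2$ times, are perfect and the family of these DAGs implies exactly the same CSI statements as $\mathcal M(\mathcal T)$.
   Context: Notation. $[p]=\{1,\dots,p\}$; $X_1,\dots,X_p$ are discrete random variables, $X_i$ with state space $[d_i]=\{1,\dots,d_i\}$. For $A\subseteq[p]$ let $\mathcal R_A=\prod_{i\in A}[d_i]$, $\mathcal R=\mathcal R_{[p]}$. For $\mathbf x\in\mathcal R_B$ and $A\subseteq B$, $\mathbf x_A=(x_i)_{i\in A}$; for disjoint $A,B$, $\mathbf x_A\mathbf x_B\in\mathcal R_{A\cup B}$ is the combined outcome. $\Delta^\circ_{|\mathcal R|-1}$ is the set of strictly positive probability distributions on $\mathcal R$. CStrees. Let $\mathcal T=(V,E)$ be the rooted tree with $V=\{\mathrm{root}\}\cup\bigcup_{j\in[p]}\mathcal R_{[j]}$ and edges $\mathrm{root}\to x_1$ and $x_1\cdots x_{k-1}\to x_1\cdots x_k$. Its $k$-th level is $L_k=\mathcal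 R_{[k]}$ ($L_0=\{\mathrm{root}\}$); $E(v)$ is the set of outgoing edges of $v$. A labeling $\theta:E\to\mathcal L$ ($\mathcal L$ a finite set) makes $\mathcal T$ a staged tree if $|\theta(E(v))|=|E(v)|$ for all $v$, and $\theta(E(v)),\theta(E(w))$ are equal or disjoint for all $v,w$. Non-leaf vertices $v,w$ are in the same stage iff $\theta(E(v))=\theta(E(w))$; the equivalence classes are the stages (leaves are regarded as singleton stages). A staged tree is a CStree if: (1) $\theta(E(v))\ne\theta(E(w))$ for non-leaf $v,w$ in different levels; (2) $\theta(x_1\cdots x_{k-1}\to x_1\cdots x_{k-1}x_k)=\theta(y_1\cdots y_{k-1}\to y_1\cdots y_{k-1}x_k)$ whenever $x_1\cdots x_{k-1}$ and $y_1\cdots y_{k-1}$ are in the same stage; (3) for every $k\in[p]$ and every stage $S\subseteq L_{k-1}$ there are $C\subseteq[k-1]$ and $\mathbf x_C\in\mathcal R_C$ with $S=\{\mathbf x_C\mathbf y:\mathbf y\in\mathcal R_{[k-1]\setminus C}\}$. Model. $\mathcal M(\mathcal T)\subseteq\Delta^\circ_{|\mathcal R|-1}$ is the set of all $f$ of the form $f(\mathbf x)=\prod_{e\in E(\mathrm{root}\to\mathbf x)}x_{\theta(e)}$, where $E(\mathrm{root}\to\mathbf x)$ is the set of edges of the path from the root to $\mathbf x$, the parameters $x_{\theta(e)}\in(0,1)$ are indexed by labels, and $\sum_{e\in E(v)}x_{\theta(e)}=1$ for each non-leaf $v$. Balanced. For $v\in L_{k-1}$ let $t(v)=\sum_{\mathbf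 z\in\mathcal R_{[p]\setminus[k-1]}}\prod_{e\in E(v\to v\mathbf z)}\theta(e)$ in the polynomial ring $\mathbb R[\theta(e):e\in E]$ whose variables are the labels. $\mathcal T$ is balanced if for every $k\in[p]$, all $v,w\in L_{k-1}$ in the same stage and all $s,r\in[d_k]$: $t(vs)t(wr)=t(vr)t(ws)$ in this ring. ($\mathcal M(\mathcal T)$ is then called a decomposable CSmodel.) CSI statements. For pairwise disjoint $A,B,S,C\subseteq[p]$ and $\mathbf x_C\in\mathcal R_C$, a distribution $f$ satisfies the CSI statement $X_A\perp X_B\mid X_S,X_C=\mathbf x_C$ if $f(\mathbf x_A|\mathbf x_B,\mathbf x_S,\mathbf x_C)=f(\mathbf x_A|\mathbf x_S,\mathbf x_C)$ for all $\mathbf x_A,\mathbf x_B,\mathbf x_S$ (trivial if $A$ or $B$ is empty). If $C=\emptyset$ it is a CI statement. $\mathcal J(\mathcal T)$. For a stage $S\subseteq L_{k-1}$ let $C\subseteq[k-1]$ be the set of indices at which all elements of $S$ agree and $\mathbf x_C$ the common value; the stage statement is $X_k\perp X_{[k-1]\setminus C}\mid X_C=\mathbf x_C$. $\mathcal J(\mathcal T)$ is the set of all CSI statements derivable from the stage statements by the CSI axioms (all index sets disjoint; $A\perp B|S,\mathbf x_C$ abbreviates $X_A\perp X_B|X_S,X_C=\mathbf x_C$): symmetry: $A\perp B|S,\mathbf x_C\Rightarrow B\perp A|S,\mathbf x_C$; decomposition: $A\perp B\cup D|S,\mathbf x_C\Rightarrow A\perp B|S,\mathbf x_C$; weak union: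 $A\perp B\cup D|S,\mathbf x_C\Rightarrow A\perp B|S\cup D,\mathbf x_C$; contraction: $A\perp B|S\cup D,\mathbf x_C$ and $A\perp D|S,\mathbf x_C\Rightarrow A\perp B\cup D|S,\mathbf x_C$; intersection: $A\perp B|S\cup D,\mathbf x_C$ and $A\perp S|B\cup D,\mathbf x_C\Rightarrow A\perp B\cup S|D,\mathbf x_C$; specialization: $A\perp B|S,\mathbf x_C$, $T\subseteq S$, $\mathbf x_T\in\mathcal R_T\Rightarrow A\perp B|S\setminus T,\mathbf x_{T\cup C}$; absorption: if for some $T\subseteq C$ one has $A\perp B|S,\mathbf x_{C\setminus T}\mathbf x_T$ for all $\mathbf x_T\in\mathcal R_T$, then $A\perp B|S\cup T,\mathbf x_{C\setminus T}$. Minimal contexts. $X_C=\mathbf x_C$ (with $C\subseteq[p]$, possibly empty) is a minimal context of $\mathcal T$ if there is a statement $X_A\perp X_B|X_S,X_C=\mathbf x_C$ in $\mathcal J(\mathcal T)$ with $A,B\neq\emptyset$ such that for no nonempty $T\subseteq C$ is $X_A\perp X_B|X_{S\cup T},X_{C\setminus T}=\mathbf x_{C\setminus T}$ in $\mathcal J(\mathcal T)$. $\mathcal C_{\mathcal T}$ is the set of minimal contexts. For a DAG $G$, $\mathrm{global}(G)$ is the set of all CI statements given by d-separation in $G$. Let $\mathcal J(X_C=\mathbf x_C)$ be the set of CI statements $X_A\perp X_B|X_S$ with $A,B,S\subseteq[p]\setminus C$ and $X_A\perp X_B|X_S,X_C=\mathbf x_C\in\mathcal J(\mathcal T)$. The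 minimal context DAG $G_{X_C=\mathbf x_C}$ is the DAG on $[p]\setminus C$, with all edges $i\to j$ satisfying $i<j$, that is a minimal I-MAP of $\mathcal J(X_C=\mathbf x_C)$: $\mathrm{global}(G_{X_C=\mathbf x_C})\subseteq\mathcal J(X_C=\mathbf x_C)$, and this fails after removing any edge. Directed moralization. For a DAG $G$ with all edges $i\to j$ satisfying $i<j$, $G^{dm}$ is the DAG on the same vertices with all edges of $G$ and an edge $u\to v$ whenever $u<v$ and $u\to w$, $v\to w$ are edges of $G$ for some $w$. $G^{\mathrm{per}}$ is obtained from $G$ by applying this operation $\binom p2$ times. A DAG is perfect if for every vertex $k$ any two parents of $k$ are adjacent. Implication. A family of DAGs $(H_{X_C=\mathbf x_C})_{(X_C=\mathbf x_C)}$, $H_{X_C=\mathbf x_C}$ a DAG on $[p]\setminus C$, implies a CSI statement $\sigma$ if every $f\in\Delta^\circ_{|\mathcal R|-1}$ satisfying $X_A\perp X_B|X_S,X_C=\mathbf x_C$ for all members of the family and all $X_A\perp X_B|X_S\in\mathrm{global}(H_{X_C=\mathbf x_C})$ also satisfies $\sigma$. The model $\mathcal M(\mathcal T)$ implies $\sigma$ if every $f\in\mathcal M(\mathcal T)$ satisfies $\sigma$. *)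

(* Defs.v *)
From mathcomp Require Import all_boot all_order all_algebra.
From mathcomp Require Import reals.
From mathcomp Require Import mpoly.

Set Implicit Arguments.
Unset Strict Implicit.
Unset Printing Implicit Defensive.

Import Order.TTheory GRing.Theory Num.Theory.
Local Open Scope ring_scope.

(* Everything is indexed from 0: the variables are indexed by 'I_p, the state
   space of variable i is 'I_(d i), and [prefix_set p k] is the set {0,...,k-1}
   of the first k variables. *)

Section Outcomes.
Variables (p : nat) (d : 'I_p -> nat).

Definition outcome := {dffun forall i : 'I_p, 'I_(d i)}.

(* An element x_A of R_A is encoded as a partial assignment with domain
   exactly A, so that every partial outcome has a unique representation. *)
Definition pout := {dffun forall i : 'I_p, option 'I_(d i)}.

Definition dom (c : pout) : {set 'I_p} := [set i | c i != None].

Definition Rset (A : {set 'I_p}) : {set pout} := [set c | dom c == A].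

Definition full (x : outcome) : pout := finfun (fun i => Some (x i)).

Definition restr (A : {set 'I_p}) (c : pout) : pout :=
  finfun (fun i => if i \in A then c i else None).

(* The combined outcome; only used when [dom a] and [dom b] are disjoint. *)
Definition merge (a b : pout) : pout :=
  finfun (fun i => if a i is Some s then Some s else b i).

(* The assignment v extended (or updated) by x_k = s. *)
Definition ext (v : pout) (k : 'I_p) (s : 'I_(d k)) : pout :=
  finfun (dfwith v (Some s)).

Definition prefix_set (k : nat) : {set 'I_p} := [set i : 'I_p | (i < k)%N].

End Outcomes.

Arguments outcome {p} d.
Arguments pout {p} d.
Arguments prefix_set p k : clear implicits.

Section Tree.
Variables (p : nat) (d : 'I_p -> nat).

Definition level (k : nat) : {set pout d} := Rset d (prefix_set p k).

Definition vertex (v : pout d) : Prop := exists k : 'I_p.+1, v \in level k.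

Definition nonleaf (v : pout d) : bool := [exists k : 'I_p, v \in level k].

Definition edge (v w : pout d) : bool :=
  [exists k : 'I_p, (v \in level k) && [exists s : 'I_(d k), w == ext v s]].

(* The outgoing edges of v, identified with their targets. *)
Definition out (v : pout d) : {set pout d} := [set w | edge v w].

(* A labeling gives the label [theta v w] of the edge v -> w; its values on
   pairs that are not edges of the tree are irrelevant. *)
Variables (L : finType) (theta : pout d -> pout d -> L).

Definition out_labels (v : pout d) : {set L} := [set theta v w | w in out v].

Definition staged_tree : Prop :=
  (forall v, vertex v -> #|out_labels v| = #|out v|) /\
  (forall v w, vertex v -> vertex w ->
     out_labels v = out_labels w \/ [disjoint out_labels v & out_labels w]).

Definition same_stage (v w : pout d) : bool :=
  [&& nonleaf v, nonleaf w & out_labels v == out_labels w].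

Definition stage (v : pout d) : {set pout d} := [set w | same_stage v w].

Definition cstree : Prop :=
  [/\ staged_tree,
      forall (j k : 'I_p) v w, j != k -> v \in level j -> w \in level k ->
        out_labels v <> out_labels w,
      forall (k : 'I_p) v w (s : 'I_(d k)), v \in level k -> w \in level k ->
        same_stage v w -> theta v (ext v s) = theta w (ext w s)
    & forall (k : 'I_p) v, v \in level k ->
        exists2 c : pout d, dom c \subset prefix_set p k &
          stage v = [set merge c y | y in Rset d (prefix_set p k :\: dom c)]].

(* The product of the parameters a over the edges of the path from the level-k
   ancestor of the leaf x to x. *)
Definition path_prod (T : comNzRingType) (a : L -> T) (k : nat) (x : outcome d)
    : T :=
  \prod_(j < p | (k <= j)%N)
     a (theta (restr (prefix_set p j) (full x))
              (restr (prefix_set p j.+1) (full x))).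

Definition open_simplex (R : realType) (f : outcome d -> R) : Prop :=
  (forall x, 0 < f x) /\ \sum_x f x = 1.

Definition model (R : realType) (f : outcome d -> R) : Prop :=
  open_simplex f /\
  exists a : L -> R,
    [/\ forall v w, edge v w -> 0 < a (theta v w) < 1,
        forall v, nonleaf v -> \sum_(w in out v) a (theta v w) = 1
      & forall x, f x = path_prod a 0 x].

(* Multinomials index variables by ordinals, hence the use of enum_rank. *)
Definition label_var (R : realType) (l : L) : {mpoly R[#|L|]} :=
  'X_(enum_rank l).

Definition interp_poly (R : realType) (k : nat) (v : pout d)
    : {mpoly R[#|L|]} :=
  \sum_(x : outcome d | restr (prefix_set p k) (full x) == v)
     path_prod (label_var R) k x.

Definition balanced (R : realType) : Prop :=
  forall (k : 'I_p) v w (s r : 'I_(d k)),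
    v \in level k -> w \in level k -> same_stage v w ->
    interp_poly R k.+1 (ext v s) * interp_poly R k.+1 (ext w r)
    = interp_poly R k.+1 (ext v r) * interp_poly R k.+1 (ext w s).

End Tree.

Definition pairwise_disjoint (p : nat) (s : seq {set 'I_p}) : bool :=
  pairwise (fun A B : {set 'I_p} => [disjoint A & B]) s.

Section CSI.
Variables (p : nat) (d : 'I_p -> nat).

(* [Csi A B S c] is the statement X_A _||_ X_B | X_S, X_C = x_C, where the
   context x_C is c and C is [dom c]. *)
Record csi := Csi {
  lhs : {set 'I_p};
  rhs : {set 'I_p};
  cond : {set 'I_p};
  ctx : pout d }.

Definition csi_valid (q : csi) : bool :=
  pairwise_disjoint [:: lhs q; rhs q; cond q; dom (ctx q)].

Definition prob (R : realType) (f : outcome d -> R) (c : pout d) : R :=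
  \sum_(x : outcome d | restr (dom c) (full x) == c) f x.

Definition cprob (R : realType) (f : outcome d -> R) (a b : pout d) : R :=
  prob f (merge a b) / prob f b.

Definition sat (R : realType) (f : outcome d -> R) (q : csi) : Prop :=
  forall xA xB xS : pout d,
    xA \in Rset d (lhs q) -> xB \in Rset d (rhs q) -> xS \in Rset d (cond q) ->
    cprob f xA (merge xB (merge xS (ctx q))) = cprob f xA (merge xS (ctx q)).

(* Closure under the CSI axioms; the sets are allowed to be empty. *)
Inductive csi_derivable (base : csi -> Prop) : csi -> Prop :=
| csi_base q : base q -> csi_derivable base q
| csi_symmetry (A B S : {set 'I_p}) (c : pout d) :
    pairwise_disjoint [:: A; B; S; dom c] ->
    csi_derivable base (Csi A B S c) ->
    csi_derivable base (Csi B A S c)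
| csi_decomposition (A B D S : {set 'I_p}) (c : pout d) :
    pairwise_disjoint [:: A; B; D; S; dom c] ->
    csi_derivable base (Csi A (B :|: D) S c) ->
    csi_derivable base (Csi A B S c)
| csi_weak_union (A B D S : {set 'I_p}) (c : pout d) :
    pairwise_disjoint [:: A; B; D; S; dom c] ->
    csi_derivable base (Csi A (B :|: D) S c) ->
    csi_derivable base (Csi A B (S :|: D) c)
| csi_contraction (A B D S : {set 'I_p}) (c : pout d) :
    pairwise_disjoint [:: A; B; D; S; dom c] ->
    csi_derivable base (Csi A B (S :|: D) c) ->
    csi_derivable base (Csi A D S c) ->
    csi_derivable base (Csi A (B :|: D) S c)
| csi_intersection (A B D S : {set 'I_p}) (c : pout d) :
    pairwise_disjoint [:: A; B; D; S; dom c] ->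
    csi_derivable base (Csi A B (S :|: D) c) ->
    csi_derivable base (Csi A S (B :|: D) c) ->
    csi_derivable base (Csi A (B :|: S) D c)
| csi_specialization (A B S T : {set 'I_p}) (c xT : pout d) :
    pairwise_disjoint [:: A; B; S; dom c] ->
    T \subset S -> xT \in Rset d T ->
    csi_derivable base (Csi A B S c) ->
    csi_derivable base (Csi A B (S :\: T) (merge xT c))
| csi_absorption (A B S T : {set 'I_p}) (c : pout d) :
    pairwise_disjoint [:: A; B; S; T; dom c] ->
    (forall xT, xT \in Rset d T ->
       csi_derivable base (Csi A B S (merge xT c))) ->
    csi_derivable base (Csi A B (S :|: T) c).

End CSI.

Section TreeStatements.
Variables (p : nat) (d : 'I_p -> nat) (L : finType).
Variable theta : pout d -> pout d -> L.

Definition common_indices (k : nat) (S : {set pout d}) : {set 'I_p} :=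
  [set i in prefix_set p k | [forall v in S, forall w in S, v i == w i]].

Definition stage_statement (q : csi d) : Prop :=
  exists (k : 'I_p) (v : pout d), v \in level d k /\
    let C := common_indices k (stage theta v) in
    q = Csi [set k] (prefix_set p k :\: C) set0 (restr C v).

Definition J_tree (q : csi d) : Prop := csi_derivable stage_statement q.

Definition min_context (c : pout d) : Prop :=
  exists A B S : {set 'I_p},
    [/\ A != set0, B != set0, J_tree (Csi A B S c)
      & forall T : {set 'I_p}, T \subset dom c -> T != set0 ->
          ~ J_tree (Csi A B (S :|: T) (restr (dom c :\: T) c))].

End TreeStatements.

Section DAGs.
Variable p : nat.

(* A directed graph is given by its set of edges; the vertex set is kept
   separately. *)
Definition digraph := {set 'I_p * 'I_p}.

(* All edges i -> j satisfy i < j; in particular G is acyclic. *)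
Definition ordered_dag (V : {set 'I_p}) (G : digraph) : Prop :=
  forall i j, (i, j) \in G -> [/\ i \in V, j \in V & (i < j)%N].

Definition arrow (G : digraph) : rel 'I_p := fun i j => (i, j) \in G.

Definition adjacent (G : digraph) : rel 'I_p :=
  fun i j => arrow G i j || arrow G j i.

(* A collider on a path is active given S iff it or one of its descendants
   is in S; a noncollider is active iff it is not in S. *)
Definition active_triple (G : digraph) (S : {set 'I_p}) (u m w : 'I_p) : bool :=
  if arrow G u m && arrow G w m
  then [exists x in S, connect (arrow G) m x]
  else m \notin S.

Fixpoint active (G : digraph) (S : {set 'I_p}) (s : seq 'I_p) : bool :=
  if s is u :: s1 then
    (if s1 is m :: w :: _ then active_triple G S u m w else true)
    && active G S s1
  else true.

Definition dsep (G : digraph) (A B S : {set 'I_p}) : Prop :=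
  forall a s, a \in A -> last a s \in B ->
    path (adjacent G) a s -> uniq (a :: s) -> ~~ active G S (a :: s).

(* [dag_global V G A B S]: X_A _||_ X_B | X_S is in global(G), where G has
   vertex set V. *)
Definition dag_global (V : {set 'I_p}) (G : digraph) (A B S : {set 'I_p})
    : Prop :=
  [/\ A \subset V, B \subset V, S \subset V,
      pairwise_disjoint [:: A; B; S] & dsep G A B S].

Definition dm (G : digraph) : digraph :=
  G :|: [set e : 'I_p * 'I_p | (e.1 < e.2)%N &&
                 [exists w, arrow G e.1 w && arrow G e.2 w]].

Definition per (G : digraph) : digraph := iter 'C(p, 2) dm G.

Definition perfect (G : digraph) : Prop :=
  forall k i j, arrow G i k -> arrow G j k -> i != j -> adjacent G i j.

End DAGs.

Section Families.
Variables (p : nat) (d : 'I_p -> nat).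

Definition J_context (J : csi d -> Prop) (c : pout d) (A B S : {set 'I_p})
    : Prop :=
  [/\ A \subset ~: dom c, B \subset ~: dom c, S \subset ~: dom c
    & J (Csi A B S c)].

Definition imap (J : csi d -> Prop) (c : pout d) (G : digraph p) : Prop :=
  forall A B S, dag_global (~: dom c) G A B S -> J_context J c A B S.

Definition min_context_dag (J : csi d -> Prop) (c : pout d) (G : digraph p)
    : Prop :=
  [/\ ordered_dag (~: dom c) G, imap J c G
    & forall e, e \in G -> ~ imap J c (G :\ e)].

Definition family_implies (R : realType) (ctxs : pout d -> Prop)
    (H : pout d -> digraph p) (q : csi d) : Prop :=
  forall f : outcome d -> R, open_simplex f ->
    (forall c, ctxs c -> forall A B S, dag_global (~: dom c) (H c) A B S ->
       sat f (Csi A B S c)) ->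
    sat f q.

Definition model_implies (R : realType) (L : finType)
    (theta : pout d -> pout d -> L) (q : csi d) : Prop :=
  forall f : outcome d -> R, model theta f -> sat f q.

End Families.

(* Main.v *)
(* The axioms generating J(T) are sound for positive distributions and adding
   edges to a DAG only removes d-separations, so M(T) satisfies all statements
   of the moralized family.  Conversely, let f satisfy these and let
   X_k _||_ X_B | x_C be a stage statement.  Comparing coefficients in the
   balancedness identities shows, level by level, that in the context x_C the
   stages of the next variable depend only on one of the two sides; so the
   statement grows within J(T) to X_P _||_ X_Q | x_C with k in P, B in Q and
   P, Q, C covering all variables.  Move a maximal part T of C behind the bar:
   the remaining context x_{C \ T} is minimal, and its minimal I-MAP has no edge
   between P and Q.  A common child of u in P and v in Q would have to lie in
   T, whose indices precede k and hence P, so moralization creates none either.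
   Hence P and Q remain d-separated by T, and f satisfies
   X_P _||_ X_Q | X_T, x_{C \ T}, which specializes to the stage statement. *)
Require Import Defs.
From mathcomp Require Import all_boot all_order all_algebra.
From mathcomp Require Import reals.
From mathcomp Require Import boolp mpoly ring lra.

Set Implicit Arguments.
Unset Strict Implicit.
Unset Printing Implicit Defensive.

Import Order.TTheory GRing.Theory Num.Theory.
Local Open Scope ring_scope.

(* [path.merge] shadows the merge of partial outcomes. *)
Local Notation merge := Defs.merge.

(** For positive [f], membership in the model is equivalent to the stage statements ([model_stage],
    [stage_model]), so it suffices to recover these from the moralized graphs. Knowing how stages
    depend on the two sides is not enough to pass to the next level. The invariant [splits]
    therefore pairs the statement of J(T) with [exchange], a rank-one condition on the interpolating
    polynomials below the context; balancedness is its first instance, and it is what determines the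
    stages of the next variable. Coefficients are compared by evaluation: the labels of one level
    are set to 0 or 1 ([relabel]), which leaves all later levels unchanged, and positivity excludes
    cancellation. That a minimal I-MAP has no edge between P and Q is not immediate, since
    minimality speaks of all d-separations. All such edges are deleted at once; the local Markov
    statements survive by the intersection axiom, and a Verma-Pearl argument inside J(T) turns them
    back into global ones. Everything is proved for an arbitrary number of moralizations. *)

Lemma pairwise_disjoint3 (p : nat) (A B C : {set 'I_p}) :
  pairwise_disjoint [:: A; B; C] =
  [&& [disjoint A & B], [disjoint A & C] & [disjoint B & C]].
Proof. by rewrite /pairwise_disjoint /= !andbT -!andbA. Qed.

Lemma pairwise_disjoint4 (p : nat) (A B C D : {set 'I_p}) :
  pairwise_disjoint [:: A; B; C; D] =
  [&& [disjoint A & B], [disjoint A & C], [disjoint A & D],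
      [disjoint B & C], [disjoint B & D] & [disjoint C & D]].
Proof. by rewrite /pairwise_disjoint /= !andbT -!andbA. Qed.

Lemma pairwise_disjoint5 (p : nat) (A B C D E : {set 'I_p}) :
  pairwise_disjoint [:: A; B; C; D; E] =
  [&& [disjoint A & B], [disjoint A & C], [disjoint A & D], [disjoint A & E],
      [disjoint B & C], [disjoint B & D], [disjoint B & E],
      [disjoint C & D], [disjoint C & E] & [disjoint D & E]].
Proof. by rewrite /pairwise_disjoint /= !andbT -!andbA. Qed.

Lemma disjoint_setUl (T : finType) (A B C : {set T}) :
  [disjoint A :|: B & C] = [disjoint A & C] && [disjoint B & C].
Proof. by rewrite !disjoints_subset subUset. Qed.

Lemma disjoint_setUr (T : finType) (A B C : {set T}) :
  [disjoint A & B :|: C] = [disjoint A & B] && [disjoint A & C].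
Proof. by rewrite !disjoints_subset setCU subsetI. Qed.

Lemma disjoint_set0r (T : finType) (A : {set T}) : [disjoint A & set0].
Proof. by rewrite disjoints_subset setC0 subsetT. Qed.

Lemma disjoint_set0l (T : finType) (A : {set T}) : [disjoint set0 & A].
Proof. by rewrite disjoints_subset sub0set. Qed.

Definition disjointE := (disjoint_setUl, disjoint_setUr, disjoint_set0l,
  disjoint_set0r, pairwise_disjoint3, pairwise_disjoint4, pairwise_disjoint5).

Ltac split_disjoint := repeat match goal with
  | H : is_true (pairwise_disjoint _) |- _ => move: H; rewrite ?disjointE => H
  | H : is_true (_ && _) |- _ => case/andP: H => ? ?
  end.

Ltac solve_disjoint := rewrite ?disjointE; repeat (apply/andP; split);
  try (done || (rewrite disjoint_sym; done)).

Ltac set_bool :=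
  apply/setP => ?; rewrite !inE; repeat (case: (_ \in _)); repeat (case: (_ != _)).

(** * Outcomes agreeing on an index set, and marginals as sums over them *)

Section Agreement.
Variables (p : nat) (d : 'I_p -> nat).
Implicit Types (x y z : outcome d) (U D : {set 'I_p}) (c : pout d).

Definition agree U x y := restr U (full x) == restr U (full y).

Lemma agreeP U x y : reflect (forall i, i \in U -> x i = y i) (agree U x y).
Proof.
apply: (iffP eqP) => [e i iU|e].
  by have := congr1 (fun g : pout d => g i) e; rewrite !ffunE iU => -[].
by apply/ffunP => i; rewrite !ffunE; case: ifP => // /e ->.
Qed.

Lemma agree_refl U x : agree U x x. Proof. exact: eqxx. Qed.

Lemma agree_sym U x y : agree U x y = agree U y x.
Proof. exact: eq_sym. Qed.

Lemma agree_trans U x y z : agree U x y -> agree U y z -> agree U x z.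
Proof. by move=> /eqP e1 /eqP e2; apply/eqP; rewrite e1. Qed.

Lemma agreeS U D x y : U \subset D -> agree D x y -> agree U x y.
Proof. by move=> /subsetP s /agreeP e; apply/agreeP => i /s/e. Qed.

Lemma agreeU U D x y : agree (U :|: D) x y = agree U x y && agree D x y.
Proof.
apply/agreeP/andP => [e|[/agreeP e1 /agreeP e2] i].
  by split; apply/agreeP => i iU; apply: e; rewrite inE iU ?orbT.
by rewrite inE => /orP[/e1|/e2].
Qed.

Definition mix D x y : outcome d := finfun (fun i => if i \in D then y i else x i).

Lemma mixE D x y i : mix D x y i = if i \in D then y i else x i.
Proof. by rewrite ffunE. Qed.

Lemma agree_mixl U D x y : [disjoint U & D] -> agree U (mix D x y) x.
Proof.
by move=> UD; apply/agreeP => i iU; rewrite mixE (disjointFr UD).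
Qed.

(* [sum_agree g U x] is the marginal g(x_U). *)
Definition sum_agree (T : nmodType) (g : outcome d -> T) U x : T :=
  \sum_(y | agree U y x) g y.

Lemma sum_agree_eq (T : nmodType) (g : outcome d -> T) U x y :
  agree U x y -> sum_agree g U x = sum_agree g U y.
Proof.
move=> xy; apply: eq_bigl => z.
apply/idP/idP => h; apply: (agree_trans h) => //.
by rewrite agree_sym.
Qed.

(** The outcomes [z] differing from [x] at most on [D] represent the values on [D], so that
    marginalization never leaves full outcomes. *)
Lemma sum_agree_split (T : nmodType) (g : outcome d -> T) U D x :
  [disjoint U & D] ->
  sum_agree g U x = \sum_(z | agree (~: D) z x) sum_agree g (U :|: D) z.
Proof.
move=> UD; rewrite /sum_agree.
rewrite (partition_big (mix D x) (fun z => agree (~: D) z x)) /=; last first.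
  by move=> y _; apply: agree_mixl; rewrite disjoints_subset.
apply: eq_bigr => z /agreeP zx; apply: eq_bigl => y.
apply/andP/idP => [[/agreeP yx /eqP yz]|].
  apply/agreeP => i; rewrite inE => /orP[iU|iD].
    by rewrite yx // zx // inE (disjointFr UD iU).
  by rewrite -yz mixE iD.
rewrite agreeU => /andP[/agreeP yzU /agreeP yzD]; split.
  by apply/agreeP => i iU; rewrite yzU // zx // inE (disjointFr UD iU).
apply/eqP/ffunP => i; rewrite mixE; case: ifPn => [/yzD//|iD].
by rewrite zx // inE.
Qed.

Lemma sum_agree0 (T : nmodType) (g : outcome d -> T) x :
  sum_agree g set0 x = \sum_y g y.
Proof. by apply: eq_bigl => y; apply/agreeP => i; rewrite inE. Qed.

Lemma sum_agreeT (T : nmodType) (g : outcome d -> T) x :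
  sum_agree g setT x = g x.
Proof.
rewrite /sum_agree (big_pred1 x) // => y.
by apply/agreeP/eqP => [e|-> //]; apply/ffunP => i; apply: e.
Qed.

Definition set1v x (k : 'I_p) (s : 'I_(d k)) : outcome d := finfun (dfwith x s).

Lemma set1v_in x (k : 'I_p) (s : 'I_(d k)) : set1v x s k = s.
Proof. by rewrite ffunE dfwith_in. Qed.

Lemma set1v_out x (k : 'I_p) (s : 'I_(d k)) i : i != k -> set1v x s i = x i.
Proof. by move=> ik; rewrite ffunE dfwith_out // eq_sym. Qed.

Lemma agree_set1v U x k (s : 'I_(d k)) : k \notin U -> agree U (set1v x s) x.
Proof.
move=> kU; apply/agreeP => i iU; rewrite set1v_out //.
by apply: contraNneq kU => <-.
Qed.

Lemma set1v_id x (k : 'I_p) : set1v x (x k) = x.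
Proof.
apply/ffunP => i; have [->|ik] := eqVneq i k; first by rewrite set1v_in.
by rewrite set1v_out.
Qed.

Lemma sum_agree_split1 (T : nmodType) (g : outcome d -> T) U (k : 'I_p) x :
  k \notin U ->
  sum_agree g U x = \sum_(s : 'I_(d k)) sum_agree g (k |: U) (set1v x s).
Proof.
move=> kU; rewrite (sum_agree_split _ (D := [set k])); last first.
  by rewrite disjoint_sym disjoints1.
rewrite (reindex_onto (fun s : 'I_(d k) => set1v x s) (fun z => z k)) /=.
  rewrite setUC; apply: eq_bigl => s; rewrite set1v_in eqxx andbT.
  by apply: agree_set1v; rewrite !inE eqxx.
move=> z /agreeP zx; apply/ffunP => i.
have [->|ik] := eqVneq i k; first by rewrite set1v_in.
by rewrite set1v_out // zx // !inE.
Qed.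

Definition ctx_agree c x := restr (dom c) (full x) == c.

Lemma ctx_agreeP c x :
  reflect (forall i, c i != None -> c i = Some (x i)) (ctx_agree c x).
Proof.
apply: (iffP eqP) => [<- i|e].
  by rewrite !ffunE; case: ifP.
apply/ffunP => i; rewrite !ffunE inE; case: ifPn => [/e ->//|].
by rewrite negbK => /eqP.
Qed.

Lemma dom_restr U c : dom (restr U c) = U :&: dom c.
Proof. by apply/setP => i; rewrite !inE ffunE; case: (i \in U). Qed.

Lemma dom_full x : dom (full x) = setT.
Proof. by apply/setP => i; rewrite !inE ffunE. Qed.

Lemma dom_restr_full U x : dom (restr U (full x)) = U.
Proof. by rewrite dom_restr dom_full setIT. Qed.

Lemma dom_merge (a b : pout d) : dom (merge a b) = dom a :|: dom b.
Proof. by apply/setP => i; rewrite !inE ffunE; case: (a i). Qed.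

Lemma ctx_agree_restr U x y : ctx_agree (restr U (full y)) x = agree U x y.
Proof. by rewrite /ctx_agree dom_restr_full. Qed.

Lemma ctx_agree_merge (a b : pout d) x :
  ctx_agree a x -> ctx_agree b x -> ctx_agree (merge a b) x.
Proof.
move=> /ctx_agreeP ha /ctx_agreeP hb; apply/ctx_agreeP => i; rewrite ffunE.
by have := ha i; have := hb i; case: (a i) => // s _ /(_ isT).
Qed.

Lemma ctx_agree_mergel (a b : pout d) x :
  ctx_agree (merge a b) x -> ctx_agree a x.
Proof.
move=> /ctx_agreeP h; apply/ctx_agreeP => i; have := h i; rewrite ffunE.
by case: (a i) => [s|] // /(_ isT).
Qed.

Lemma ctx_agree_merger (a b : pout d) x :
  [disjoint dom a & dom b] -> ctx_agree (merge a b) x -> ctx_agree b x.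
Proof.
move=> ab /ctx_agreeP h; apply/ctx_agreeP => i bi; have := h i.
rewrite ffunE; have : i \notin dom a.
  by apply/negP => ia; have := disjointFr ab ia; rewrite inE bi.
by rewrite inE negbK => /eqP ->; apply.
Qed.

Lemma ctx_agree_trans c x y : ctx_agree c x -> agree (dom c) x y -> ctx_agree c y.
Proof. by move=> /eqP e /eqP e2; rewrite /ctx_agree -e2 e. Qed.

Lemma ctx_agree_agree c x y : ctx_agree c x -> ctx_agree c y -> agree (dom c) x y.
Proof. by move=> /eqP e /eqP e2; rewrite /agree e e2. Qed.

Lemma ctx_agree_ex (hd : forall i, (0 < d i)%N) c : exists x, ctx_agree c x.
Proof.
exists (finfun (fun i => odflt (Ordinal (hd i)) (c i))).
by apply/ctx_agreeP => i; rewrite ffunE; case: (c i).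
Qed.

Lemma restr_dom c : restr (dom c) c = c.
Proof.
apply/ffunP => i; rewrite ffunE inE; case: ifPn => //.
by rewrite negbK => /eqP ->.
Qed.

Lemma restr_restr U D c : restr U (restr D c) = restr (U :&: D) c.
Proof.
apply/ffunP => i; rewrite !ffunE inE.
by case: (i \in U); case: (i \in D).
Qed.

Lemma merge_restr U D x :
  merge (restr U (full x)) (restr D (full x)) = restr (U :|: D) (full x).
Proof.
apply/ffunP => i; rewrite !ffunE inE.
by case: (i \in U); case: (i \in D).
Qed.

End Agreement.

(** * CSI statements as division-free identities between marginals *)

Section Satisfaction.
Variables (R : realType) (p : nat) (d : 'I_p -> nat).
Variables (f : outcome d -> R) (f_gt0 : forall x, 0 < f x).
Implicit Types (x y : outcome d) (A B S D : {set 'I_p}) (c : pout d).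

Local Notation pr := (sum_agree f).

Lemma sum_agree_gt0 A x : 0 < pr A x.
Proof.
rewrite /sum_agree (bigD1 x) ?agree_refl //= ltr_pwDl ?f_gt0 //.
by apply: sumr_ge0 => y _; apply: ltW.
Qed.

Lemma sum_agree_neq0 A x : pr A x != 0.
Proof. by rewrite gt_eqF // sum_agree_gt0. Qed.

(* The division-free form of [sat], in which the context is only a condition
   on the outcomes considered. *)
Definition ci A B S c : Prop := forall x, ctx_agree c x ->
  pr (A :|: B :|: S :|: dom c) x * pr (S :|: dom c) x
  = pr (A :|: S :|: dom c) x * pr (B :|: S :|: dom c) x.

Definition ciq (q : csi d) := ci (lhs q) (rhs q) (cond q) (ctx q).

Lemma prob_restr A x : prob f (restr A (full x)) = pr A x.
Proof. by rewrite /prob dom_restr_full. Qed.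

(** Positivity clears the denominators. Since all state spaces are nonempty, [xA], [xB], [xS] and
    the context extend to one full outcome, at which both forms are compared. *)
Lemma sat_ciP (hd : forall i, (0 < d i)%N) q : csi_valid q -> sat f q <-> ciq q.
Proof.
case: q => A B S c; rewrite /csi_valid pairwise_disjoint4 /ciq /sat /ci /=.
case/and5P => AB AS Ac BS /andP[Bc Sc].
have key x : ctx_agree c x ->
  (cprob f (restr A (full x))
         (merge (restr B (full x)) (merge (restr S (full x)) c)) =
   cprob f (restr A (full x)) (merge (restr S (full x)) c)) <->
  (pr (A :|: B :|: S :|: dom c) x * pr (S :|: dom c) x
  = pr (A :|: S :|: dom c) x * pr (B :|: S :|: dom c) x).
  move=> /eqP cx; rewrite -[in cprob _ _ _]cx -[X in _ = cprob _ _ (merge _ X)]cx.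
  rewrite /cprob !merge_restr !prob_restr !setUA.
  have n1 := sum_agree_neq0 (B :|: S :|: dom c) x.
  have n2 := sum_agree_neq0 (S :|: dom c) x.
  split=> [/eqP|] e; last by apply/eqP; rewrite eqr_div // e.
  by move: e; rewrite eqr_div // => /eqP.
split=> [h x cx|h xA xB xS].
  by apply/(key x cx)/h; rewrite inE dom_restr_full.
rewrite !inE => /eqP hA /eqP hB /eqP hS.
have [x] := ctx_agree_ex hd (merge xA (merge xB (merge xS c))).
move=> hx; have xa := ctx_agree_mergel hx.
have d1 : [disjoint dom xA & dom (merge xB (merge xS c))].
  by rewrite !dom_merge hA hB hS; solve_disjoint.
have {}hx := ctx_agree_merger d1 hx; have xb := ctx_agree_mergel hx.
have d2 : [disjoint dom xB & dom (merge xS c)].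
  by rewrite !dom_merge hB hS; solve_disjoint.
have {}hx := ctx_agree_merger d2 hx; have xs := ctx_agree_mergel hx.
have d3 : [disjoint dom xS & dom c] by rewrite hS.
have {}hx := ctx_agree_merger d3 hx.
move: (xa) (xb) (xs); rewrite /ctx_agree hA hB hS => /eqP <- /eqP <- /eqP <-.
by apply/(key x hx)/h.
Qed.

End Satisfaction.

(** * Soundness of the CSI axioms for positive distributions *)

Section Soundness.
Variables (R : realType) (p : nat) (d : 'I_p -> nat).
Variables (f : outcome d -> R) (f_gt0 : forall x, 0 < f x).
Implicit Types (x y : outcome d) (A B S D T : {set 'I_p}) (c : pout d).

Local Notation pr := (sum_agree f).

Lemma ci_symmetry A B S c : ci f A B S c -> ci f B A S c.
Proof. by move=> h x /h; rewrite (setUC B A) [RHS]mulrC. Qed.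

(** The identity is summed over the values on [D]; the two factors whose index sets avoid [B] and
    [D] are constant in this sum. *)
Lemma ci_decomposition A B D S c :
  pairwise_disjoint [:: A; B; D; S; dom c] ->
  ci f A (B :|: D) S c -> ci f A B S c.
Proof.
move=> dj h x cx; split_disjoint.
rewrite (sum_agree_split _ (D := D) _ (U := A :|: B :|: S :|: dom c));
  last by solve_disjoint.
rewrite (sum_agree_split _ (D := D) _ (U := B :|: S :|: dom c));
  last by solve_disjoint.
rewrite mulr_suml mulr_sumr; apply: eq_bigr => z zx.
have zU (U : {set 'I_p}) : [disjoint U & D] -> agree U x z.
  move=> hU; rewrite agree_sym; apply: agreeS zx.
  by rewrite -disjoints_subset.
have cz : ctx_agree c z.
  by apply: ctx_agree_trans cx _; apply: zU; solve_disjoint.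
have := h z cz.
rewrite (@sum_agree_eq _ _ _ f (S :|: dom c) x z); last by apply: zU; solve_disjoint.
rewrite (@sum_agree_eq _ _ _ f (A :|: S :|: dom c) x z);
  last by apply: zU; solve_disjoint.
have -> : A :|: B :|: S :|: dom c :|: D = A :|: (B :|: D) :|: S :|: dom c.
  by set_bool.
by have -> : B :|: S :|: dom c :|: D = B :|: D :|: S :|: dom c by set_bool.
Qed.

Lemma ci_weak_union A B D S c :
  pairwise_disjoint [:: A; B; D; S; dom c] ->
  ci f A (B :|: D) S c -> ci f A B (S :|: D) c.
Proof.
move=> dj h x cx.
have h' : ci f A D S c.
  apply: (ci_decomposition (D := B)); last by rewrite setUC.
  by split_disjoint; solve_disjoint.
have := h x cx; have := h' x cx.
have -> : A :|: (B :|: D) :|: S :|: dom c = A :|: B :|: (S :|: D) :|: dom c.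
  by set_bool.
have -> : A :|: D :|: S :|: dom c = A :|: (S :|: D) :|: dom c by set_bool.
have -> : D :|: S :|: dom c = S :|: D :|: dom c by set_bool.
have -> : B :|: D :|: S :|: dom c = B :|: (S :|: D) :|: dom c by set_bool.
have n := sum_agree_neq0 f_gt0 (S :|: dom c) x.
move: (pr _ x) (pr _ x) (pr _ x) (pr _ x) (pr _ x) (pr _ x) n.
move=> a b e g k l n h1 h2; apply: (mulIf n).
by rewrite mulrAC h2 mulrAC -h1; ring.
Qed.

Lemma ci_contraction A B D S c :
  ci f A B (S :|: D) c -> ci f A D S c -> ci f A (B :|: D) S c.
Proof.
move=> h h' x cx; have := h x cx; have := h' x cx.
have -> : A :|: (B :|: D) :|: S :|: dom c = A :|: B :|: (S :|: D) :|: dom c.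
  by set_bool.
have -> : A :|: D :|: S :|: dom c = A :|: (S :|: D) :|: dom c by set_bool.
have -> : D :|: S :|: dom c = S :|: D :|: dom c by set_bool.
have -> : B :|: D :|: S :|: dom c = B :|: (S :|: D) :|: dom c by set_bool.
have n := sum_agree_neq0 f_gt0 (S :|: D :|: dom c) x.
move: n; set n := pr (S :|: D :|: dom c) x.
move: n (pr _ x) (pr _ x) (pr _ x) (pr _ x) (pr _ x).
move=> n a b e g k n0 h1 h2; apply: (mulIf n0).
by transitivity (k * g * a); [rewrite mulrAC h2 | rewrite h1]; ring.
Qed.

(** Both hypotheses compute the conditional of [A] given [B], [S], [D], whence [key]: conditioning
    [A] on [S], [D] or on [B], [D] gives the same. Summing over the values on [B] makes [A]
    independent of [S] given [D], and a contraction finishes. Positivity is what allows the common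
    factors to be cancelled. *)
Lemma ci_intersection A B D S c :
  pairwise_disjoint [:: A; B; D; S; dom c] ->
  ci f A B (S :|: D) c -> ci f A S (B :|: D) c -> ci f A (B :|: S) D c.
Proof.
move=> dj h h'; split_disjoint.
have key x : ctx_agree c x ->
    pr (A :|: S :|: D :|: dom c) x * pr (B :|: D :|: dom c) x
    = pr (A :|: B :|: D :|: dom c) x * pr (S :|: D :|: dom c) x.
  move=> cx; have := h x cx; have := h' x cx.
  have -> : A :|: S :|: (B :|: D) :|: dom c = A :|: B :|: (S :|: D) :|: dom c.
    by set_bool.
  have -> : S :|: (B :|: D) :|: dom c = B :|: (S :|: D) :|: dom c by set_bool.
  rewrite !setUA.
  have n := sum_agree_neq0 f_gt0 (B :|: S :|: D :|: dom c) x.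
  move: n; set n := pr (B :|: S :|: D :|: dom c) x.
  move: n (pr _ x) (pr _ x) (pr _ x) (pr _ x) (pr _ x).
  move=> n a b e g k n0 h1 h2; apply: (mulIf n0).
  by transitivity (k * g * b); [rewrite mulrAC -h2 | rewrite h1]; ring.
have AS x : ctx_agree c x ->
    pr (A :|: S :|: D :|: dom c) x * pr (D :|: dom c) x
    = pr (A :|: D :|: dom c) x * pr (S :|: D :|: dom c) x.
  move=> cx.
  rewrite (sum_agree_split _ (D := B) _ (U := D :|: dom c));
    last by solve_disjoint.
  rewrite (sum_agree_split _ (D := B) _ (U := A :|: D :|: dom c));
    last by solve_disjoint.
  rewrite [LHS]mulr_sumr [RHS]mulr_suml; apply: eq_bigr => z zx.
  have zU (U : {set 'I_p}) : [disjoint U & B] -> agree U x z.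
    move=> hU; rewrite agree_sym; apply: agreeS zx.
    by rewrite -disjoints_subset.
  have cz : ctx_agree c z.
    by apply: ctx_agree_trans cx _; apply: zU; solve_disjoint.
  rewrite (@sum_agree_eq _ _ _ f (A :|: S :|: D :|: dom c) x z);
    last by apply: zU; solve_disjoint.
  rewrite (@sum_agree_eq _ _ _ f (S :|: D :|: dom c) x z);
    last by apply: zU; solve_disjoint.
  have -> : D :|: dom c :|: B = B :|: D :|: dom c by set_bool.
  have -> : A :|: D :|: dom c :|: B = A :|: B :|: D :|: dom c by set_bool.
  exact: key.
move=> x cx; have := AS x cx; have := h x cx.
rewrite !setUA.
have n := sum_agree_neq0 f_gt0 (S :|: D :|: dom c) x.
move: n; set n := pr (S :|: D :|: dom c) x.
move: n (pr _ x) (pr _ x) (pr _ x) (pr _ x) (pr _ x).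
move=> n a b e g k n0 h1 h2; apply: (mulIf n0).
by transitivity (g * b * e); [rewrite mulrAC h1 | rewrite h2]; ring.
Qed.

(** The context enters [ci] only through the outcomes considered: moving [T] into it keeps all four
    index sets and merely restricts [x]. Absorption is the same observation read backwards. *)
Lemma ci_specialization A B S T c (xT : pout d) :
  pairwise_disjoint [:: A; B; S; dom c] -> T \subset S -> dom xT = T ->
  ci f A B S c -> ci f A B (S :\: T) (merge xT c).
Proof.
move=> dj TS dT h x cx; split_disjoint.
have {}cx : ctx_agree c x.
  apply: ctx_agree_merger cx; rewrite dT; apply: disjointWl TS _ => //.
have e (U : {set 'I_p}) :
    U :|: (S :\: T) :|: dom (merge xT c) = U :|: S :|: dom c.
  rewrite dom_merge dT !setUA; congr (_ :|: _); rewrite -setUA; congr (_ :|: _).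
  by rewrite setDE setUIl (setUidPl TS) setUC setUCr setIT.
have := h x cx; rewrite !e.
by have := e set0; rewrite !set0U => ->.
Qed.

Lemma ci_absorption A B S T c :
  [disjoint T & dom c] ->
  (forall xT, dom xT = T -> ci f A B S (merge xT c)) -> ci f A B (S :|: T) c.
Proof.
move=> Tc h x cx.
have := h (restr T (full x)) (dom_restr_full _ _) x.
rewrite dom_merge dom_restr_full -!setUA; apply.
by apply: ctx_agree_merge => //; rewrite ctx_agree_restr agree_refl.
Qed.

Lemma csi_sound (base : csi d -> Prop) q :
  (forall q, base q -> ciq f q) -> csi_derivable base q -> ciq f q.
Proof.
move=> hb; elim=> {q}.
- by move=> q /hb.
- by move=> A B S c _ _; apply: ci_symmetry.
- by move=> A B D S c dj _; apply: ci_decomposition.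
- by move=> A B D S c dj _; apply: ci_weak_union.
- by move=> A B D S c _ _ h _ h'; exact: ci_contraction h h'.
- by move=> A B D S c dj _ h _ h'; exact: ci_intersection dj h h'.
- move=> A B S T c xT dj TS; rewrite inE => /eqP dT _.
  exact: ci_specialization.
- move=> A B S T c dj _ h; apply: ci_absorption => [|xT dT].
    by split_disjoint.
  by apply: h; rewrite inE dT.
Qed.

End Soundness.

(** * Active walks and d-separation in increasing graphs *)

Lemma nonuniq_split (T : eqType) (s : seq T) : ~~ uniq s ->
  exists s1 m s2 s3, s = s1 ++ m :: s2 ++ m :: s3.
Proof.
elim: s => //= x s IH; rewrite negb_and negbK => /orP[|/IH].
  by case/splitPr => s2 s3; exists [::], x, s2, s3.
by case=> s1 [m [s2 [s3 ->]]]; exists (x :: s1), m, s2, s3.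
Qed.

Section Walks.
Variable p : nat.
Implicit Types (G H : digraph p) (A B S : {set 'I_p}) (s t : seq 'I_p).

Definition increasing G := forall i j, arrow G i j -> (i < j)%N.

Lemma increasingS G H : G \subset H -> increasing H -> increasing G.
Proof. by move=> /subsetP GH hH i j /GH; apply: hH. Qed.

Lemma ordered_increasing V G : ordered_dag V G -> increasing G.
Proof. by move=> h i j /h[]. Qed.

Lemma adjacent_sym G i j : adjacent G i j = adjacent G j i.
Proof. exact: orbC. Qed.

Lemma adjacentS G H i j : G \subset H -> adjacent G i j -> adjacent H i j.
Proof. by move=> /subsetP h /orP[/h|/h] e; apply/orP; [left|right]. Qed.

Lemma connect_leq G i j : increasing G -> connect (arrow G) i j -> (i <= j)%N.
Proof.
move=> hG /connectP[s + ->]; elim: s i => //= k s IH i /andP[/hG/ltnW ik /IH].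
exact: leq_trans.
Qed.

Lemma active_triple_sym G S u m w : active_triple G S u m w = active_triple G S w m u.
Proof. by rewrite /active_triple andbC. Qed.

Lemma active_cat2 G S s u m t :
  active G S (s ++ [:: u, m & t]) =
  active G S (s ++ [:: u; m]) && active G S [:: u, m & t].
Proof.
elim: s => [|x s IH]; first by [].
case: s IH => [_|y [|z s]]; first by rewrite /= !andbT.
  by rewrite -[[:: x, y & _] ++ _]/([:: x, y, u, m & t]) /= !andbT -!andbA.
move=> IH; rewrite -![(x :: y :: z :: s) ++ _]/(x :: (y :: z :: s) ++ _).
set l := (y :: z :: s) ++ _ in IH *.
set r := (y :: z :: s) ++ _ in IH *.
have e1 : active G S (x :: l) = active_triple G S x y z && active G S l by [].
have e2 : active G S (x :: r) = active_triple G S x y z && active G S r by [].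
by rewrite e1 e2 IH andbA.
Qed.

Lemma active_rev G S s : active G S (rev s) = active G S s.
Proof.
elim: s => // x [|y [|z s]] // IH.
have e : rev [:: x, y, z & s] = rev s ++ [:: z; y; x].
  by rewrite !rev_cons -!cats1 -!catA.
have e' : rev [:: y, z & s] = rev s ++ [:: z; y] by rewrite !rev_cons -!cats1 -catA.
by rewrite e active_cat2 -e' IH /= andbT andbC active_triple_sym.
Qed.

(* Walking down an edge, an active walk can turn back up only at a collider with
   a descendant in S. *)
Lemma active_descent G S u v s : increasing G ->
  (forall x, x \in S -> ~~ connect (arrow G) v x) ->
  arrow G u v -> path (adjacent G) v s -> active G S [:: u, v & s] ->
  (u < last v s)%N.
Proof.
move=> hG; elim: s u v => [|w s IH] u v hv uv /=; first by move=> _ _; apply: hG.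
case/andP=> vw ws /andP[]; rewrite /active_triple uv /=.
case: ifPn => [_ /existsP[x /andP[xS]]|wv _ h]; first by rewrite (negbTE (hv x xS)).
have {}vw : arrow G v w by move: vw; rewrite /adjacent (negbTE wv) orbF.
apply: (ltn_trans (hG _ _ uv)); apply: (IH v w) => // x xS.
by apply: contra (hv x xS); apply: connect_trans; apply: connect1.
Qed.

(** Only the triple at [m] is new after the detour is cut out. If [m] becomes a collider without
    descendant in [S], the detour must have left [m] downwards, and by [active_descent] it could not
    have returned to [m]. If [m] becomes a noncollider lying in [S], both of its old occurrences had
    to be colliders, so both remaining edges point to [m], a contradiction. *)
Lemma active_shortcut G S s1 m s2 s3 : increasing G ->
  sorted (adjacent G) (s1 ++ m :: s2 ++ m :: s3) ->
  active G S (s1 ++ m :: s2 ++ m :: s3) ->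
  sorted (adjacent G) (s1 ++ m :: s3) && active G S (s1 ++ m :: s3).
Proof.
move=> hG; rewrite !sorted_cat_cons cat_path => /and3P[h1 h2 h3].
move=> hact; apply/andP; split.
  by rewrite h1; move: h3 => /= /andP[].
have actr (s t : seq 'I_p) : active G S (s ++ t) -> active G S t.
  by elim: s => //= x s IH; case: (s ++ t) IH => [|y [|z r]] //= IH /andP[_ /IH].
have hm : active G S (m :: s3).
  by apply: (actr (s1 ++ m :: s2)); rewrite -catA.
have actl (s t : seq 'I_p) : active G S (s ++ t) -> active G S s.
  by rewrite -active_rev rev_cat => /actr; rewrite active_rev.
case/lastP: s1 h1 hact => [//|s1 x] h1 hact.
move: hact; rewrite !cat_rcons => hact.
case: s3 h3 hact hm => [|y s3] h3 hact hm.
  by apply: (actl _ (s2 ++ [:: m])); rewrite -catA.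
rewrite active_cat2; apply/andP; split.
  by apply: (actl _ (s2 ++ [:: m, y & s3])); rewrite -catA.
have -> : active G S [:: x, m, y & s3] =
  active_triple G S x m y && active G S [:: m, y & s3] by [].
rewrite hm andbT.
case: s2 h2 h3 hact => [|z s2] h2 h3 hact.
  by move: h3 => /= /andP[]; rewrite /adjacent orbb => /hG; rewrite ltnn.
have t1 : active_triple G S x m z.
  by move: hact; rewrite active_cat2 => /andP[_ /andP[]].
have t2 : active_triple G S (last z s2) m y.
  have e : rcons s1 x ++ m :: (z :: s2) ++ m :: y :: s3 =
      (s1 ++ [:: x, m & belast z s2]) ++ [:: last z s2, m, y & s3].
    by rewrite cat_rcons -catA (lastI z s2) cat_rcons.
  move: hact; rewrite -cat_rcons e active_cat2 => /andP[_].
  by case/andP.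
rewrite /active_triple; case: ifPn => [/andP[xm ym]|].
  apply: contraT => /existsPn hS.
  have hSc w : w \in S -> ~~ connect (arrow G) m w.
    by move=> wS; have := hS w; rewrite wS.
  have zm : ~~ arrow G z m.
    apply/negP => zm; move: t1; rewrite /active_triple xm zm /=.
    by case/existsP => w /andP[/hSc/negbTE ->].
  have mz : arrow G m z.
    by move: h2 => /= /andP[+ _]; rewrite /adjacent (negbTE zm) orbF.
  have := @active_descent G S m z (rcons s2 m) hG _ mz.
  rewrite last_rcons ltnn; apply.
  - move=> w /hSc; apply: contra; apply: connect_trans; exact: connect1.
  - by move: h2 h3; rewrite /= rcons_path => /andP[_ ->] /andP[].
  - apply: (actl _ (y :: s3)); apply: (actr (rcons s1 x)).
    by move: hact; rewrite cat_rcons /= cat_rcons.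
rewrite negb_and => h; apply: contraL h => mS; rewrite negb_or !negbK.
move: t1 t2; rewrite /active_triple mS /=.
by case: ifP => // /andP[-> _] _; case: ifP => // /andP[_ ->].
Qed.

(* [dsep] with walks in place of paths, which can be freely concatenated. *)
Definition wsep G A B S := forall a s, a \in A -> last a s \in B ->
  path (adjacent G) a s -> ~~ active G S (a :: s).

(** Cutting out a detour shortens an active walk and keeps its endpoints, so induction on the length
    ends at a path. *)
Lemma dsep_wsep G A B S : increasing G -> dsep G A B S -> wsep G A B S.
Proof.
move=> hG hd a s; have [n] := ubnP (size s); elim: n a s => // n IH a s sn aA sB hs.
have [u|/nonuniq_split[s1 [m [s2 [s3 e]]]]] := boolP (uniq (a :: s)).
  exact: hd.
apply/negP => hact; have hso : sorted (adjacent G) (a :: s) by [].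
rewrite e in hact hso.
have /andP[] := active_shortcut hG hso hact.
have : (size (s1 ++ m :: s3) < size (a :: s))%N.
  by rewrite e !size_cat /= size_cat /= ltn_add2l ltnS addnS ltnS leq_addl.
have : last a (s1 ++ m :: s3) = last a s.
  by have := congr1 (last a) e; rewrite /= !last_cat /= last_cat => ->.
have : head a (s1 ++ m :: s3) = a.
  by have := congr1 (head a) e; case: (s1).
have : s1 ++ m :: s3 <> [::] by case: (s1).
case: (s1 ++ m :: s3) => [//|a' t] /= _ -> et /ltnSE ts ht ha.
by have := IH a t (leq_trans ts sn) aA; rewrite et => /(_ sB ht); rewrite /= ha.
Qed.


Lemma wsep_sym G A B S : wsep G A B S -> wsep G B A S.
Proof.
move=> h b s bB sA hs.
have e : b :: s = rcons (belast b s) (last b s) by rewrite -lastI.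
have hr : rev (b :: s) = last b s :: rev (belast b s) by rewrite e rev_rcons.
rewrite -active_rev hr; apply: h => //.
  by case: (s) => //= x t; rewrite rev_cons last_rcons.
by rewrite rev_path; under eq_path do rewrite adjacent_sym.
Qed.

(** As [H] is increasing, it contains no reversal of an edge of [G]: colliders and noncolliders keep
    their type, and colliders can only gain descendants. *)
Lemma active_tripleS G H S u m w : G \subset H -> increasing H ->
  adjacent G u m -> adjacent G m w ->
  active_triple G S u m w -> active_triple H S u m w.
Proof.
move=> GH hH um mw.
have e i j : adjacent G i j -> arrow H i j = arrow G i j.
  move=> hij; apply/idP/idP => [ij|]; last exact: (subsetP GH).
  case/orP: hij => // /(subsetP GH)/hH ji.
  by have := ltn_trans (hH _ _ ij) ji; rewrite ltnn.
rewrite /active_triple (e _ _ um) (e w m) 1?adjacent_sym //.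
case: ifP => // _ /existsP[x /andP[xS mx]]; apply/existsP; exists x; rewrite xS /=.
apply: connect_sub mx => i j ij; apply: connect1; exact: (subsetP GH).
Qed.

Lemma activeS G H S a s : G \subset H -> increasing H ->
  path (adjacent G) a s -> active G S (a :: s) -> active H S (a :: s).
Proof.
move=> GH hH; elim: s a => // m s IH a /= /andP[am ms] /andP[h1 h2].
apply/andP; split; last exact: IH.
case: s ms h1 {h2 IH} => // w s /= /andP[mw _].
exact: active_tripleS.
Qed.

Lemma pathS G H a s : G \subset H ->
  path (adjacent G) a s -> path (adjacent H) a s.
Proof. by move=> GH; apply: sub_path => i j; apply: adjacentS. Qed.

Lemma wsepS G H A B S : G \subset H -> increasing H ->
  wsep H A B S -> wsep G A B S.
Proof.
move=> GH hH h a s aA sB hs; apply: contra (h a s aA sB (pathS GH hs)).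
exact: activeS.
Qed.

Lemma dsepS G H A B S : G \subset H -> increasing H ->
  dsep H A B S -> dsep G A B S.
Proof.
move=> GH hH h a s aA sB hs u; apply: contra (h a s aA sB (pathS GH hs) u).
exact: activeS.
Qed.

Lemma wsepU G A B B' S : wsep G A B S -> wsep G A B' S -> wsep G A (B :|: B') S.
Proof.
move=> h h' a s aA; rewrite inE => /orP[]; [exact: h|exact: h'].
Qed.

End Walks.

(** * Deciding relations between finite sets pointwise *)

Lemma subset_at (T : finType) (A B : {set T}) i :
  A \subset B -> (i \in A) ==> (i \in B).
Proof. by move=> /subsetP h; apply/implyP/h. Qed.

Lemma disjoint_at (T : finType) (A B : {set T}) i :
  [disjoint A & B] -> ~~ ((i \in A) && (i \in B)).
Proof.
by move=> h; apply/negP => /andP[iA iB]; rewrite (disjointFr h iA) in iB.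
Qed.

Lemma disjoint_from_at (T : finType) (A B : {set T}) :
  (forall i, ~~ ((i \in A) && (i \in B))) -> [disjoint A & B].
Proof.
move=> h; rewrite disjoints_subset; apply/subsetP => i iA; rewrite inE.
by have := h i; rewrite iA.
Qed.

Lemma eq_at (T : finType) (A B : {set T}) i :
  A = B -> ~~ xorb (i \in A) (i \in B).
Proof. by move=> ->; case: (_ \in _). Qed.

Lemma eq_from_at (T : finType) (A B : {set T}) :
  (forall i, ~~ xorb (i \in A) (i \in B)) -> A = B.
Proof. by move=> h; apply/setP => i; have := h i; do 2!case: (_ \in _). Qed.

Lemma subset_from_at (T : finType) (A B : {set T}) :
  (forall i, (i \in A) ==> (i \in B)) -> A \subset B.
Proof. by move=> h; apply/subsetP => i; apply/implyP. Qed.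

Ltac first_bool g :=
  match g with
  | context [?b] =>
      let _ := match goal with _ => is_var b end in
      lazymatch type of b with bool => constr:(b) end
  end.

Ltac bool_split :=
  cbn [negb andb orb implb xorb];
  lazymatch goal with
  | |- is_true true => exact isT
  | |- is_true ?g => let b := first_bool g in destruct b; bool_split
  end.

(* Reduces a set inclusion, disjointness or equality to a boolean tautology in
   the memberships of a point, using all such facts from the context. *)
Ltac set_solve :=
  split_disjoint; rewrite ?disjointE; repeat (apply/andP; split);
  let i := fresh "i" in
  match goal with
  | |- is_true (_ \subset _) => apply: subset_from_at => i
  | |- is_true [disjoint _ & _] => apply: disjoint_from_at => i
  | |- @eq {set _} _ _ => apply: eq_from_at => i
  | |- is_true true => done
  end;
  let nc := fresh "nc" in apply: contraT => nc;
  repeat match goal with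
  | H : is_true (_ \subset _) |- _ => move: (subset_at i H); clear H
  | H : is_true [disjoint _ & _] |- _ => move: (disjoint_at i H); clear H
  | H : @eq {set _} _ _ |- _ => move: (eq_at i H); clear H
  end;
  move: nc; rewrite ?inE; repeat (move: (_ \in _) => ?); repeat (move: (_ == _) => ?);
  repeat (move: (_ < _)%N => ?); repeat (move: (arrow _ _ _) => ?);
  repeat match goal with
  | |- is_true _ -> is_true _ => apply/implyP
  | |- is_true ?a -> is_true ?b -> _ =>
      let h1 := fresh in let h2 := fresh in
      move=> h1 h2; move: (introT andP (conj h1 h2)) => {h1 h2}
  end; bool_split.

(** * From the local to the global Markov property by the CSI axioms *)

Section VermaPearl.
Variables (p : nat) (d : 'I_p -> nat) (base : csi d -> Prop) (c : pout d).
Implicit Types (G H : digraph p) (A B S D : {set 'I_p}) (n : 'I_p).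

Local Notation V := (~: dom c).

Definition Jc A B S := csi_derivable base (Csi A B S c).

Lemma Jc_symmetry A B S : pairwise_disjoint [:: A; B; S; dom c] ->
  Jc A B S -> Jc B A S.
Proof. exact: csi_symmetry. Qed.

Lemma Jc_subset A B B' S : B' \subset B -> pairwise_disjoint [:: A; B; S; dom c] ->
  Jc A B S -> Jc A B' S.
Proof.
move=> sB dj; have e : B = B' :|: (B :\: B') by set_solve.
rewrite e; apply: csi_decomposition; set_solve.
Qed.

Lemma Jc_weak_union A B S S' : S \subset S' -> S' \subset S :|: B ->
  pairwise_disjoint [:: A; B; S; dom c] -> Jc A B S -> Jc A (B :\: S') S'.
Proof.
move=> s1 s2 dj h; have -> : S' = S :|: (S' :\: S) by set_solve.
apply: csi_weak_union; first by set_solve.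
by have -> : B :\: (S :|: S' :\: S) :|: S' :\: S = B; first set_solve.
Qed.

Definition parents G n := [set u | arrow G u n].

Definition preds n := V :&: prefix_set p n.

(** For an increasing graph this is the subgraph induced on the first [m] vertices, because a tail
    lies below its head. *)
Definition trunc G (m : nat) : digraph p := [set e in G | (e.2 < m)%N].

Lemma trunc_arrow G m i j : arrow (trunc G m) i j = arrow G i j && (j < m)%N.
Proof. by rewrite /arrow inE. Qed.

Lemma truncS G m m' : (m <= m')%N -> trunc G m \subset trunc G m'.
Proof.
move=> mm; apply/subsetP => e; rewrite !inE => /andP[-> h].
exact: leq_trans h mm.
Qed.

Lemma trunc_increasing G m : increasing G -> increasing (trunc G m).
Proof. by move=> hG i j; rewrite trunc_arrow => /andP[/hG]. Qed.

Variables (G : digraph p) (G_dag : ordered_dag V G).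
(** Trivial statements are not among the axioms, so the start of the induction is assumed; an I-MAP
    supplies it. *)
Hypothesis J0 : Jc set0 set0 set0.
Hypothesis G_local : forall n, n \in V ->
  Jc [set n] (preds n :\: parents G n) (parents G n).

Let G_incr : increasing G := ordered_increasing G_dag.

Lemma parents_preds n : parents G n \subset preds n.
Proof. apply/subsetP => u; rewrite inE => /G_dag[uV _ un].
by rewrite inE uV inE. Qed.

Section Step.
Variable (n : 'I_p).
Hypothesis IH : forall A B S, pairwise_disjoint [:: A; B; S; dom c] ->
  A :|: B :|: S \subset prefix_set p n -> wsep (trunc G n) A B S -> Jc A B S.

Let nG := trunc G n.+1.
Let nG_incr : increasing nG.
Proof. exact: trunc_increasing. Qed.
Let nGS : trunc G n \subset nG := truncS G (leqnSn n).

Lemma sink_arrow i : arrow nG n i = false.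
Proof.
rewrite trunc_arrow; apply/negP => /andP[/G_incr ni].
by rewrite ltnS leqNgt ni.
Qed.

(** A sink occurs inside a walk only as a collider, so conditioning on it blocks nothing. *)
Lemma active_sink S a s : n \in S -> path (adjacent nG) a s ->
  active nG (S :\ n) (a :: s) -> active nG S (a :: s).
Proof.
move=> nS; elim: s a => // m s IHs a /= /andP[am ms] /andP[h1 h2].
apply/andP; split; last exact: IHs.
case: s ms h1 {h2 IHs} => // w s /= /andP[mw _].
rewrite /active_triple; case: ifP => [_ /existsP[x /andP[]]|].
  by rewrite inE => /andP[_ xS] mx; apply/existsP; exists x; rewrite xS.
move=> h; rewrite !inE negb_and negbK => /orP[/eqP mn|//].
move: am mw h; rewrite mn /adjacent !sink_arrow orbF => ->.
by rewrite /= => ->.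
Qed.

(** Active walks from [A] and from [B] to the sink [n] could be joined at [n], which is then a
    collider in [S], giving an active walk from [A] to [B]. The joined walk may repeat vertices,
    which is why separation by walks is used. *)
Lemma wsep_sink A B S : n \in S -> wsep nG A B S ->
  [disjoint A & S] -> [disjoint B & S] ->
  wsep nG A [set n] (S :\ n) \/ wsep nG B [set n] (S :\ n).
Proof.
move=> nS sep AS BS; have grow a s := @active_sink S a s nS.
apply: contrapT => /not_orP[hA hB].
apply: hA => a s aA sn hs; apply/negP => /(grow _ _ hs) ha.
apply: hB => b t bB tn ht; apply/negP => /(grow _ _ ht) hb.
have sinkl i : adjacent nG i n -> arrow nG i n.
  by rewrite /adjacent sink_arrow orbF.
case/lastP: s => [|s z] in sn hs ha *.
  by move: sn; rewrite inE => /eqP /= e; rewrite e (disjointFl AS nS) in aA.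
case/lastP: t => [|t z'] in tn ht hb *.
  by move: tn; rewrite inE => /eqP /= e; rewrite e (disjointFl BS nS) in bB.
move: sn tn; rewrite !last_rcons !inE => /eqP ez /eqP ez'; subst z z'.
have := sep a (rcons s n ++ rev (b :: t)) aA.
rewrite last_cat rev_cons last_rcons => /(_ bB).
have hr : rev (b :: rcons t n) = n :: rcons (rev t) b.
  by rewrite rev_cons rev_rcons.
have ep : path (adjacent nG) a (rcons s n ++ rcons (rev t) b).
  rewrite cat_path hs last_rcons /=.
  have := rev_path (adjacent nG) b (rcons t n).
  rewrite last_rcons belast_rcons rev_cons => ->.
  by under eq_path do rewrite adjacent_sym.
move=> /(_ ep) /negP; apply.
have e1 : rcons (rev t) b = last b t :: rev (belast b t).
  by rewrite -rev_cons lastI rev_rcons.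
rewrite -rcons_cons lastI -!cats1 -catA /= in ha.
rewrite e1 cat_rcons -cat_cons lastI cat_rcons active_cat2.
rewrite ha /=.
have : active nG S [:: n, last b t & rev (belast b t)].
  by rewrite -e1 -hr active_rev.
move=> /= ->; rewrite andbT.
move: hs ht; rewrite !rcons_path => /andP[_ /sinkl un] /andP[_ /sinkl wn].
by rewrite /active_triple un wn; apply/existsP; exists n; rewrite nS connect0.
Qed.

Lemma local_step A B S : pairwise_disjoint [:: A; B; S; dom c] ->
  A :|: B :|: S \subset prefix_set p n.+1 -> n \in A ->
  wsep nG A B S -> Jc A B S.
Proof.
move=> dj sub nA sep.
have arr u : u \in parents G n -> arrow nG u n.
  by rewrite inE trunc_arrow ltnS leqnn andbT.
have nV : n \in V.
  have AV : A \subset V by set_solve.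
  exact: (subsetP AV).
have nE i : (i < n.+1)%N = (i == n) || (i < n)%N.
  by rewrite ltnS leq_eqVlt.
have nn : [set n] \subset A by rewrite sub1set.
have nC : [disjoint [set n] & dom c] by rewrite disjoints1 -in_setC.
have npre : [disjoint [set n] & prefix_set p n].
  by rewrite disjoints1 inE ltnn.
have pre : prefix_set p n.+1 = n |: prefix_set p n.
  by apply/setP => i; rewrite !inE nE.
have MB : [disjoint parents G n & B].
  rewrite disjoints_subset; apply/subsetP => u /arr un; rewrite inE.
  apply/negP => uB; have := sep n [:: u] nA uB.
  by rewrite /= /adjacent un orbT => /(_ isT).
have pp := parents_preds n.
have pd : preds n \subset V by apply: subsetIl.
have pd' : preds n \subset prefix_set p n by apply: subsetIr.
have dV : [disjoint V & dom c] by rewrite disjoints_subset.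
pose M := parents G n :\: S.
have sM : M \subset parents G n by apply: subsetDl.
have dM : [disjoint M & S] by rewrite disjoints_subset /M setDE subsetIr.
have hM : parents G n \subset M :|: S.
  by apply/subsetP => i; rewrite !inE => ->; case: (i \in S).
(* An active walk from a vertex of [M] to [B] could be prolonged backwards to [n]: its first vertex
   lies outside [S] and, having an arrow to [n], is a noncollider there. *)
have h1 : Jc ((A :\ n) :|: M) B S.
  apply: IH; first by clear hM; set_solve.
    rewrite pre in sub; clear hM; set_solve.
  move=> a s; rewrite inE => /orP[aA|aM] sB hs.
    apply: (wsepS nGS nG_incr sep) => //.
    by move: aA; rewrite inE => /andP[].
  have an := arr _ (subsetP sM _ aM).
  have := sep n (a :: s) nA sB; rewrite /= {1}/adjacent an orbT.
  rewrite (pathS nGS hs) => /(_ isT); apply: contra => ha.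
  apply/andP; split; last exact: activeS nGS nG_incr hs ha.
  case: (s) => // w t; rewrite /active_triple sink_arrow /=.
  by move: aM; rewrite inE => /andP[].
(* By [MB] no parent of [n] lies in [B], so [B] and the non-parents behind the bar all belong to the
   right-hand side of the local statement of [n]; weak union moves the latter. *)
have h2 : Jc [set n] B ((A :\ n) :|: M :|: S).
  have -> : B = (B :|: (((A :\ n) :|: M :|: S) :\: parents G n))
      :\: ((A :\ n) :|: M :|: S).
    by clear hM; set_solve.
  apply: (@Jc_weak_union _ _ (parents G n)).
  - by clear -hM; set_solve.
  - by clear -hM; set_solve.
  - clear hM; set_solve.
  apply: Jc_subset (G_local nV).
    rewrite pre in sub; rewrite /preds in pp pd pd' *.
    by clear -sub MB dj npre nn dM sM; set_solve.
  by clear hM; set_solve.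
have h3 : Jc B ([set n] :|: ((A :\ n) :|: M)) S.
  apply: csi_contraction; first by clear hM; set_solve.
    rewrite setUC; apply: Jc_symmetry => //.
    by clear hM; set_solve.
  by apply: Jc_symmetry h1; clear hM; set_solve.
apply: Jc_symmetry; first by clear -dj; set_solve.
apply: Jc_subset h3; first by clear; set_solve.
by clear hM; set_solve.
Qed.

End Step.

(* Verma and Pearl: remove the last vertex.  If it lies in A or B, replace it by
   its parents outside S; if it lies in S, one of A and B is separated from it,
   since it could only be a collider. *)
Theorem local_global A B S : dag_global V G A B S -> Jc A B S.
Proof.
case=> AV BV SV; rewrite pairwise_disjoint3 => /and3P[AB AS BS].
have dj : pairwise_disjoint [:: A; B; S; dom c].
  by set_solve.
move=> /(dsep_wsep G_incr) sep.
suff main m : (m <= p)%N -> forall A B S, pairwise_disjoint [:: A; B; S; dom c] ->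
    A :|: B :|: S \subset prefix_set p m -> wsep (trunc G m) A B S -> Jc A B S.
  apply: (main p) => //; first by apply/subsetP => i _; rewrite inE.
  apply: wsepS G_incr sep.
  by apply/subsetP => e; rewrite inE => /andP[].
elim: m => [_|m IHm mp] {}A {}B {}S {AB AS BS AV BV SV sep} {}dj sub sep.
  have e0 : A :|: B :|: S = set0.
    by apply/setP => i; rewrite in_set0; apply/negP => /(subsetP sub); rewrite inE.
  have [-> -> ->] : [/\ A = set0, B = set0 & S = set0]; last exact: J0.
  by move/eqP: e0; rewrite !setU_eq0 -andbA => /and3P[/eqP-> /eqP-> /eqP->].
pose n := Ordinal mp; have IHn := IHm (ltnW mp).
have lA := @local_step n IHn.
have lB A' B' S' : pairwise_disjoint [:: A'; B'; S'; dom c] ->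
    A' :|: B' :|: S' \subset prefix_set p n.+1 -> n \in B' ->
    wsep (trunc G n.+1) A' B' S' -> Jc A' B' S'.
  move=> dj' sub' nB /wsep_sym sep'; apply: Jc_symmetry; first by set_solve.
  by apply: lA => //; [set_solve | rewrite (setUC B')].
have [nA|nA] := boolP (n \in A); first exact: lA.
have [nB|nB] := boolP (n \in B); first exact: lB.
have [nS|nS] := boolP (n \in S); last first.
  apply: IHn => //; last exact: wsepS (truncS _ (leqnSn m)) (trunc_increasing G_incr) sep.
  apply/subsetP => i iU; have := subsetP sub i iU; rewrite !inE ltnS leq_eqVlt.
  case/orP => // /eqP im; have e : i = n by apply: val_inj.
  by move: iU; rewrite e !inE (negbTE nA) (negbTE nB) (negbTE nS).
have sep' : wsep (trunc G n.+1) A B (S :\ n).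
  move=> a s aA sB hs; apply: contra (sep a s aA sB hs).
  exact: active_sink nS hs.
have dAS : [disjoint A & S] by set_solve.
have dBS : [disjoint B & S] by set_solve.
have nc : [disjoint [set n] & dom c].
  have Sc : [disjoint S & dom c] by set_solve.
  by rewrite disjoints1 (disjointFr Sc nS).
have dA : [disjoint A & [set n]] by rewrite disjoint_sym disjoints1.
have dB : [disjoint B & [set n]] by rewrite disjoint_sym disjoints1.
have sub1 : [set n] \subset S by rewrite sub1set.
have eS : (S :\ n) :|: [set n] = S by rewrite setUC setD1K.
(* The sink joins the side opposite to the one it is separated from, which reduces to the case
   already settled; weak union then puts it back behind the bar. *)
have [sA|sB] := wsep_sink nS sep dAS dBS.
  rewrite -eS; apply: csi_weak_union; first by set_solve.
  apply: lB; first by set_solve.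
  - by clear -sub sub1; set_solve.
  - by rewrite !inE eqxx orbT.
  - exact: wsepU.
apply: Jc_symmetry; first by set_solve.
rewrite -eS; apply: csi_weak_union; first by set_solve.
apply: lB; first by set_solve.
- by clear -sub sub1; set_solve.
- by rewrite !inE eqxx orbT.
- by apply: wsepU => //; apply: wsep_sym.
Qed.

End VermaPearl.

(** * Minimal I-MAPs have no edge across an independence *)

Section MinimalDag.
Variables (p : nat) (d : 'I_p -> nat) (base : csi d -> Prop) (c : pout d).
Implicit Types (G H : digraph p) (A B S D P Q T : {set 'I_p}) (n : 'I_p).

Local Notation V := (~: dom c).
Local Notation J := (csi_derivable base).
Local Notation Jc := (Jc base c).
Local Notation preds := (preds c).

Lemma ordered_dagS G H : G \subset H -> ordered_dag V H -> ordered_dag V G.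
Proof. by move=> /subsetP s h i j /s/h. Qed.

(** A walk leaving [n] downwards cannot turn back, since no parent of [n] is a descendant of [n]; a
    walk leaving upwards is blocked by the parent it meets first. *)
Lemma imap_local G n : ordered_dag V G -> imap J c G -> n \in V ->
  Jc [set n] (preds n :\: parents G n) (parents G n).
Proof.
move=> G_dag h nV; have hG := ordered_increasing G_dag.
have pp := parents_preds G_dag n.
have pV : preds n \subset V by apply: subsetIl.
have pn : [disjoint [set n] & preds n] by rewrite disjoints1 !inE ltnn andbF.
suff /h[] : dag_global V G [set n] (preds n :\: parents G n) (parents G n) by [].
split.
- by rewrite sub1set.
- by clear pp; set_solve.
- exact: subset_trans pp pV.
- by set_solve.
move=> a s; rewrite inE => /eqP ->; case: s => [|m s] /=.
  by rewrite !inE ltnn !andbF.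
rewrite 2!inE => /andP[ln /setIP[_]]; rewrite inE => lp.
case/andP => /orP[nm|mn] ms _; apply/negP.
  move=> ha; have := active_descent hG _ nm ms ha.
  rewrite ltnNge (ltnW lp) /= => hd; suff : is_true false by []; apply: hd => x.
  rewrite inE => /hG xn; apply/negP => /(connect_leq hG) mx.
  by have := leq_trans (leq_ltn_trans mx xn) (ltnW (hG _ _ nm)); rewrite ltnn.
case: s ln lp ms => [|w s] ln lp _; first by rewrite /= mn in ln.
rewrite /active_triple; case: ifP => [/andP[/hG nm _]|_].
  by have := ltn_trans nm (hG _ _ mn); rewrite ltnn.
by rewrite inE mn.
Qed.

(* Intersection of the two Markov boundary statements. *)
Lemma local_shrink G X Y T n : ordered_dag V G -> imap J c G ->
  pairwise_disjoint [:: X; Y; T; dom c] -> X :|: Y :|: T = V ->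
  T \subset prefix_set p n -> n \in X -> Jc X Y T ->
  Jc [set n] (preds n :\: (parents G n :\: Y)) (parents G n :\: Y).
Proof.
move=> G_dag h dj hV Tn nX hJ; have nV : n \in V by rewrite -hV !inE nX.
have hn := imap_local G_dag h nV.
have pp := parents_preds G_dag n.
have pV : preds n \subset V by apply: subsetIl.
have pn : [disjoint [set n] & preds n] by rewrite disjoints1 !inE ltnn andbF.
have nc : [disjoint [set n] & dom c] by rewrite disjoints1 -in_setC.
have nXs : [set n] \subset X by rewrite sub1set.
have TV : T \subset preds n.
  rewrite subsetI Tn andbT; clear -hV; apply/subsetP => i iT.
  by rewrite -hV inE iT orbT.
move: (parents G n) (preds n) hn pp pV pn TV => pa pr hn pp pV pn TV.
have h1 : Jc (Y :&: pr) (n |: (X :&: pr)) T.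
  apply: (Jc_subset (B := X)).
    by rewrite subUset sub1set nX subsetIl.
    by clear -dj; set_solve.
  apply: Jc_symmetry; first by clear -dj; set_solve.
  apply: (Jc_subset (B := Y)) hJ; first by apply: subsetIl.
  by clear -dj; set_solve.
(* [T] and [X :&: pr] together are the predecessors of [n] outside [Y], so here [n] is separated
   from its predecessors in [Y] by all the others. *)
have h2 : Jc [set n] (Y :&: pr) (T :|: (X :&: pr)).
  apply: Jc_symmetry; first by clear -dj nc pn nXs TV; set_solve.
  apply: csi_weak_union; first by clear -dj nc pn nXs; set_solve.
  exact: h1.
have h3 : Jc [set n] (Y :&: pa) ((pr :\: pa) :|: (pa :\: Y)).
  have -> : Y :&: pa = (Y :&: pr) :\: ((pr :\: pa) :|: (pa :\: Y)).
    by clear -pp; set_solve.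
  apply: Jc_weak_union h2; [by clear -dj hV pV TV pp; set_solve..|].
  by clear -dj nc pn nXs TV; set_solve.
have -> : pr :\: (pa :\: Y) = (pr :\: pa) :|: (Y :&: pa) by clear -pp; set_solve.
apply: csi_intersection h3; first by clear -pp nc pn pV; set_solve.
have -> // : (Y :&: pa) :|: (pa :\: Y) = pa.
by clear; set_solve.
Qed.

Definition no_cross G P Q := forall u v, u \in P -> v \in Q -> ~~ adjacent G u v.

(** By [local_shrink] the local statements survive the deletion of all edges between [P] and [Q], so
    by [local_global] the smaller graph is an I-MAP. A graph lacking just one such edge has no
    further d-separations and is an I-MAP as well, against minimality. *)
Lemma min_dag_no_cross G P Q T : min_context_dag J c G ->
  pairwise_disjoint [:: P; Q; T; dom c] -> P :|: Q :|: T = V ->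
  (forall t u, t \in T -> u \in P -> (t < u)%N) -> Jc P Q T ->
  no_cross G P Q.
Proof.
case=> G_dag h hmin dj hV TP hJ.
pose X := [set e : 'I_p * 'I_p |
  (e.1 \in P) && (e.2 \in Q) || (e.1 \in Q) && (e.2 \in P)].
have GX : G :\: X \subset G by apply: subsetDl.
have GX_dag := ordered_dagS GX G_dag.
have hGX : imap J c (G :\: X).
  move=> A B S hs; case: (hs) => AV BV SV _ _; split=> //.
  apply: local_global hs => //.
    suff /h[] : dag_global V G set0 set0 set0 by [].
    by split; rewrite ?sub0set //; [set_solve|move=> a s; rewrite inE].
  move=> n nV; have TPs u : u \in P -> (u <= n)%N -> T \subset prefix_set p n.
    move=> uP un; apply/subsetP => t tT; rewrite inE.
    exact: leq_trans (TP t u tT uP) un.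
  have pX : parents (G :\: X) n =
      if n \in P then parents G n :\: Q else
      if n \in Q then parents G n :\: P else parents G n.
    have PQ : [disjoint P & Q] by set_solve.
    apply/setP => u; rewrite !inE /arrow !inE /=.
    case: ifPn => [nP|nP]; first by rewrite (disjointFr PQ nP) andbF andbT !inE.
    by case: ifPn => nQ; rewrite !inE ?andbF ?andbT ?orbF.
  rewrite pX; case: ifPn => [nP|nP].
    by apply: local_shrink hJ => //; exact: TPs nP _.
  case: ifPn => [nQ|nQ]; last exact: imap_local.
  (* The indices of [T] are only known to lie below those of [P]. If [n] in [Q] has a parent in [P],
     then [T] lies below that parent and hence below [n]; otherwise no edge into [n] is deleted. *)
  have [/eqP e|/set0Pn[u]] := boolP (parents G n :&: P == set0).
    have -> : parents G n :\: P = parents G n by apply/setDidPl; rewrite -setI_eq0 e.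
    exact: imap_local.
  rewrite !inE => /andP[/G_dag[_ _ un] uP].
  apply: (local_shrink (X := Q) (T := T)) => //.
  - by clear -dj; set_solve.
  - by rewrite (setUC Q).
  - by apply: TPs uP _; apply: ltnW.
  - by apply: Jc_symmetry.
move=> u v uP vQ; apply/negP => uv.
have [e eX eG] : exists2 e, e \in X & e \in G.
  by case/orP: uv => e; [exists (u, v)|exists (v, u)]; rewrite // !inE /= uP vQ ?orbT.
apply: (hmin e eG) => A B S hs; apply: hGX; case: hs => AV BV SV ds sep.
split=> //; apply: dsepS sep; last exact: increasingS (subsetDl _ _) (ordered_increasing G_dag).
apply/subsetP => e'; rewrite !inE => /andP[e'X ->]; rewrite andbT.
by apply: contraNneq e'X => ->; move: eX; rewrite inE.
Qed.

End MinimalDag.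

(** * Directed moralization: preserved separations and perfect limits *)

Section Moralization.
Variables (p : nat) (V : {set 'I_p}).
Implicit Types (G H : digraph p) (P Q T : {set 'I_p}).

Lemma dm_sub G : G \subset dm G. Proof. exact: subsetUl. Qed.

Lemma arrow_dm G i j : arrow (dm G) i j =
  arrow G i j || (i < j)%N && [exists w, arrow G i w && arrow G j w].
Proof. by rewrite /arrow /dm !inE. Qed.

Lemma dm_ordered G : ordered_dag V G -> ordered_dag V (dm G).
Proof.
move=> h i j; rewrite -/(arrow _ _ _) arrow_dm => /orP[/h//|/andP[ij /existsP[w]]].
by case/andP => /h[iV _ _] /h[jV _ _].
Qed.

Lemma iter_dm_ordered m G : ordered_dag V G -> ordered_dag V (iter m (@dm p) G).
Proof. by move=> h; elim: m => //= m; apply: dm_ordered. Qed.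

Lemma iter_dm_sub m G : G \subset iter m (@dm p) G.
Proof. by elim: m => //= m /subset_trans; apply; apply: dm_sub. Qed.

Lemma dm_no_cross G P Q T : ordered_dag V G -> V \subset P :|: Q :|: T ->
  (forall t u, t \in T -> u \in P -> (t < u)%N) ->
  no_cross G P Q -> no_cross (dm G) P Q.
Proof.
move=> h /subsetP sV TP nc u v uP vQ; have nuv := nc u v uP vQ.
have key : ~~ [exists w, arrow G u w && arrow G v w].
  apply/negP => /existsP[w /andP[uw vw]]; have [_ wV uwl] := h _ _ uw.
  have := sV w wV; rewrite !inE -orbA => /or3P[wP|wQ|wT].
  - by have := nc w v wP vQ; rewrite /adjacent vw orbT.
  - by have := nc u w uP wQ; rewrite /adjacent uw.
  - by have := ltn_trans uwl (TP w u wT uP); rewrite ltnn.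
have key' : ~~ [exists w, arrow G v w && arrow G u w].
  by apply: contra key => /existsP[w]; rewrite andbC => hw; apply/existsP; exists w.
by rewrite /adjacent !arrow_dm (negbTE key) (negbTE key') !andbF !orbF.
Qed.

Lemma iter_dm_no_cross m G P Q T : ordered_dag V G -> V \subset P :|: Q :|: T ->
  (forall t u, t \in T -> u \in P -> (t < u)%N) ->
  no_cross G P Q -> no_cross (iter m (@dm p) G) P Q.
Proof.
move=> h sV TP nc; elim: m => //= m IH.
by apply: dm_no_cross sV TP IH; apply: iter_dm_ordered.
Qed.

(** A path can leave [P] only into [T]. Indices in [T] being smaller, the edge used points back into
    [P], so the vertex of [T] is a noncollider and blocks. *)
Lemma no_cross_dsep G P Q T : ordered_dag V G -> V = P :|: Q :|: T ->
  pairwise_disjoint [:: P; Q; T] ->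
  (forall t u, t \in T -> u \in P -> (t < u)%N) ->
  no_cross G P Q -> dsep G P Q T.
Proof.
move=> h sV; rewrite pairwise_disjoint3 => /and3P[PQ PT QT] TP nc a s aP lQ hs _.
elim: s a aP lQ hs => [|m s IH] a aP /= lQ; first by rewrite (disjointFr PQ aP) in lQ.
case/andP=> am ms.
have mV : m \in V by case/orP: am => /h[].
have := mV; rewrite sV !inE -orbA => /or3P[mP|mQ|mT].
- by rewrite negb_and (IH m mP lQ ms) orbT.
- by have := nc a m aP mQ; rewrite am.
case: s lQ ms {IH} => [|w s] lQ _; first by rewrite (disjointFr QT lQ) in mT.
rewrite {1}/active_triple mT.
case: ifP => // /andP[/h[_ _ am'] _].
by have := ltn_trans am' (TP m a mT aP); rewrite ltnn.
Qed.

Lemma card_increasing G : increasing G -> (#|G| <= 'C(p, 2))%N.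
Proof.
move=> hG.
have s : G \subset [set e : 'I_p * 'I_p | (e.1 < e.2)%N].
  by apply/subsetP => -[i j] /hG; rewrite inE.
apply: leq_trans (subset_leq_card s) _.
rewrite -bin2_sum big_mkord -sum1_card.
under eq_bigl do rewrite inE.
rewrite -(pair_big_dep predT (fun i j : 'I_p => (i < j)%N) (fun _ _ => 1%N)) /=.
rewrite (exchange_big_dep predT) //=; apply: leq_sum => j _.
rewrite -(big_ord_widen p (fun _ => 1%N) (ltnW (ltn_ord j))).
by rewrite sum_nat_const card_ord muln1.
Qed.

(** A moralization that changes the graph adds an edge, and an increasing graph has at most
    ['C(p, 2)] of them, so the iteration has become stationary; a graph fixed by [dm] is perfect. *)
Lemma per_perfect G : ordered_dag V G -> perfect (per G).
Proof.
move=> h.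
have incr m : increasing (iter m (@dm p) G).
  by have := iter_dm_ordered (m := m) h; apply: ordered_increasing.
have fixed : dm (per G) = per G.
  (* The count is shifted by one: unless the iteration is stationary at [m], the next iterate has
     more than [m] edges. The induction starts because an empty [dm G] forces [G] to be empty. *)
  have grow m : iter m (@dm p) G = dm (iter m (@dm p) G) \/ (m < #|dm (iter m (@dm p) G)|)%N.
    elim: m => [|m [e|lt]] /=.
    - have [e0|[e eG]] := set_0Vmem (dm G); last by right; apply/card_gt0P; exists e.
      by left; apply/eqP; rewrite eqEsubset dm_sub e0 sub0set.
    - by left; rewrite -e.
    - have [e|ne] := eqVneq (dm (iter m (@dm p) G)) (dm (dm (iter m (@dm p) G))); first by left.
      right; apply: leq_ltn_trans lt _; apply: proper_card.
      by rewrite properEneq ne dm_sub.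
  case: (grow 'C(p, 2)) => // lt.
  by have := card_increasing (incr 'C(p, 2).+1); rewrite leqNgt lt.
move=> k i j ik jk ij; rewrite /adjacent.
wlog lij : i j ik jk ij / (i < j)%N => [hw|].
  have [lij|lji|e] := ltngtP i j; first exact: hw.
    by rewrite orbC; apply: hw => //; rewrite eq_sym.
  by rewrite (val_inj e) eqxx in ij.
rewrite -{1}fixed arrow_dm lij /=; apply/orP; left; apply/orP; right.
by apply/existsP; exists k; rewrite ik.
Qed.

End Moralization.

(** * Vertices, labels and stages of a CStree in terms of full outcomes *)

Section TreeLabels.
Variables (p : nat) (d : 'I_p -> nat) (hd : forall i : 'I_p, (2 <= d i)%N).
Variables (L : finType) (theta : pout d -> pout d -> L) (hT : cstree theta).
Implicit Types (x y z : outcome d) (k i : 'I_p) (c : pout d) (P Q : {set 'I_p}).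

Lemma d_gt0 i : (0 < d i)%N. Proof. exact: ltnW (hd i). Qed.

Lemma prefixS k : prefix_set p k.+1 = k |: prefix_set p k.
Proof. by apply/setP => i; rewrite !inE ltnS leq_eqVlt. Qed.

Lemma notin_prefix k : k \notin prefix_set p k.
Proof. by rewrite inE ltnn. Qed.

Lemma agree_prefixS k x y :
  agree (prefix_set p k.+1) x y = (x k == y k) && agree (prefix_set p k) x y.
Proof.
rewrite prefixS agreeU; congr (_ && _).
apply/agreeP/eqP => [h|h i]; first by apply: h; rewrite inE.
by rewrite inE => /eqP ->.
Qed.

(** Vertices and edges are represented by any full outcome below them, so that coordinates can be
    changed freely without tracking domains of partial assignments. *)
Definition vx (n : nat) x : pout d := restr (prefix_set p n) (full x).

Lemma vx_level n x : vx n x \in level d n.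
Proof. by rewrite inE dom_restr_full. Qed.

Lemma level_vx n v : v \in level d n -> exists x, v = vx n x.
Proof.
rewrite inE => /eqP dv; have [x /eqP hx] := ctx_agree_ex d_gt0 v.
by exists x; rewrite -hx dv.
Qed.

Lemma agree_vx n x y : agree (prefix_set p n) x y -> vx n x = vx n y.
Proof. by move/eqP. Qed.

Lemma level_inj (j k : 'I_p) v : v \in level d j -> v \in level d k -> j = k.
Proof.
rewrite !inE => /eqP -> /eqP/setP e.
have := e j; have := e k; rewrite !inE !ltnn.
by case: (ltngtP j k) => // /val_inj.
Qed.

Lemma ext_vx k x s : ext (vx k x) s = vx k.+1 (@set1v _ _ x k s).
Proof.
apply/ffunP => i; rewrite !ffunE prefixS !in_setU1.
have [->|ik] := eqVneq i k; first by rewrite !dfwith_in.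
by rewrite !dfwith_out 1?eq_sym // !ffunE.
Qed.

Lemma vx_set1v k x s : vx k (@set1v _ _ x k s) = vx k x.
Proof. exact/agree_vx/agree_set1v/notin_prefix. Qed.

Lemma out_vx k x : out (vx k x) = [set vx k.+1 (@set1v _ _ x k s) | s : 'I_(d k)].
Proof.
apply/setP => w; rewrite inE; apply/existsP/imsetP => [[j /andP[vj /existsP[s /eqP ->]]]|].
  have e := level_inj vj (vx_level k x); subst j.
  by exists s => //; rewrite ext_vx.
case=> s _ ->; exists k; rewrite vx_level; apply/existsP; exists s.
by rewrite ext_vx.
Qed.

Definition lab k x := theta (vx k x) (vx k.+1 x).

Lemma labE k x (s : 'I_(d k)) : theta (vx k x) (ext (vx k x) s) = lab k (set1v x s).
Proof. by rewrite /lab vx_set1v ext_vx. Qed.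

Lemma lab_agree k x y : agree (prefix_set p k.+1) x y -> lab k x = lab k y.
Proof.
move=> xy; rewrite /lab (agree_vx xy) (agree_vx (x := x) (y := y)) //.
by move: xy; rewrite agree_prefixS => /andP[].
Qed.

Definition labels k x : {set L} := [set lab k (set1v x s) | s : 'I_(d k)].

Lemma out_labels_vx k x : out_labels theta (vx k x) = labels k x.
Proof.
rewrite /out_labels out_vx -imset_comp; apply: eq_imset => s /=.
by rewrite /lab vx_set1v.
Qed.

Definition st k x y := labels k x == labels k y.

Lemma nonleaf_vx k x : nonleaf (vx k x).
Proof. by apply/existsP; exists k; apply: vx_level. Qed.

Lemma vertex_vx k x : vertex (vx k x).
Proof.
exists (widen_ord (leqnSn p) k); exact: vx_level.
Qed.

Lemma same_stage_vx k x y : same_stage theta (vx k x) (vx k y) = st k x y.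
Proof. by rewrite /same_stage !nonleaf_vx !out_labels_vx. Qed.

Lemma st_agree k x y : agree (prefix_set p k) x y -> st k x y.
Proof.
by move=> xy; rewrite /st -!out_labels_vx (agree_vx xy).
Qed.

Lemma st_sym k x y : st k x y = st k y x. Proof. exact: eq_sym. Qed.

Lemma st_trans k x y z : st k x y -> st k y z -> st k x z.
Proof. by move=> /eqP e1 /eqP e2; apply/eqP; rewrite e1. Qed.

Lemma st_refl k x : st k x x. Proof. exact: eqxx. Qed.

Lemma lab_labels k x y : agree (prefix_set p k) x y -> lab k y \in labels k x.
Proof.
move=> xy; apply/imsetP; exists (y k) => //; apply: lab_agree.
rewrite agree_prefixS set1v_in eqxx agree_sym /=.
by apply: agree_trans xy; apply/agree_set1v/notin_prefix.
Qed.

Lemma lab_inj k x : injective (fun s : 'I_(d k) => lab k (set1v x s)).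
Proof.
have [[hc _] _ _ _] := hT; have := hc _ (vertex_vx k x).
have inj : injective (fun s : 'I_(d k) => vx k.+1 (set1v x s)).
  move=> s r /(congr1 (fun g : pout d => g k)); rewrite !ffunE inE ltnSn.
  by rewrite !dfwith_in => -[].
rewrite out_labels_vx out_vx (card_imset _ inj) => /eqP/imset_injP h s r.
by apply: h; rewrite inE.
Qed.

(** A shared label makes the two label sets equal, as they would otherwise be disjoint; within a
    stage, labels are compatible with values, and [lab_inj] separates distinct values. *)
Lemma lab_eq k x y : (lab k x == lab k y) = st k x y && (x k == y k).
Proof.
have [[_ hdis] _ hlab _] := hT.
have key : st k x y -> lab k y = lab k (set1v x (y k)).
  move=> xy; have := hlab k (vx k x) (vx k y) (y k) (vx_level k x) (vx_level k y).
  by rewrite same_stage_vx !labE set1v_id => /(_ xy).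
apply/eqP/andP => [e|[xy /eqP e]]; last by rewrite (key xy) -e set1v_id.
have xy : st k x y.
  have := hdis _ _ (vertex_vx k x) (vertex_vx k y).
  rewrite !out_labels_vx => -[/eqP //|/disjointFr h].
  have := h _ (lab_labels (agree_refl _ x)).
  by rewrite e lab_labels ?agree_refl.
split=> //; apply/eqP/(@lab_inj k x) => /=.
by rewrite set1v_id e key.
Qed.

Lemma lab_level j k x y : lab j x = lab k y -> j = k.
Proof.
move=> e; apply/eqP; apply: contraT => jk.
have [[_ hdis] hlev _ _] := hT.
have := hdis _ _ (vertex_vx j x) (vertex_vx k y).
have := hlev j k _ _ jk (vx_level j x) (vx_level k y).
rewrite !out_labels_vx => ne [//|/disjointFr h].
have := h _ (lab_labels (agree_refl _ x)).
by rewrite e lab_labels ?agree_refl.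
Qed.

Lemma labels_st k x y : lab k x \in labels k y = st k x y.
Proof.
apply/imsetP/idP => [[s _ /eqP]|xy].
  rewrite lab_eq => /andP[h _]; apply: st_trans h _.
  exact/st_agree/agree_set1v/notin_prefix.
exists (x k) => //; apply/eqP; rewrite lab_eq set1v_in eqxx andbT.
apply: st_trans xy _; rewrite st_sym.
exact/st_agree/agree_set1v/notin_prefix.
Qed.

(** Each variable has at least two values, so a coordinate outside the context of the cylinder can
    be changed without leaving the stage; the common indices are therefore exactly those of the
    context. *)
Lemma stage_ctx k x : exists e : pout d, [/\ dom e \subset prefix_set p k,
  ctx_agree e x, (forall y, st k x y = ctx_agree e y)
  & common_indices k (stage theta (vx k x)) = dom e].
Proof.
have [_ _ _ hcyl] := hT.
have [e de he] := hcyl k _ (vx_level k x); exists e.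
have hst y : st k x y = ctx_agree e y.
  have -> : st k x y = (vx k y \in stage theta (vx k x)).
    by rewrite inE same_stage_vx.
  rewrite he; apply/imsetP/idP => [[z]|/eqP ey].
    rewrite inE => /eqP dz e2; apply/ctx_agreeP => i ei.
    have := congr1 (fun g : pout d => g i) e2; rewrite !ffunE.
    have -> : i \in prefix_set p k by apply: (subsetP de); rewrite inE.
    by case: (e i) ei => // s _ ->.
  exists (restr (prefix_set p k :\: dom e) (full y)).
    by rewrite inE dom_restr_full.
  rewrite -{1}ey merge_restr.
  by have -> : dom e :|: prefix_set p k :\: dom e = prefix_set p k
    by clear -de; set_solve.
have ex : ctx_agree e x by rewrite -hst st_refl.
split=> //; apply/setP => i; rewrite inE.
apply/andP/idP => [[ik /forallP h]|ie].
  apply: contraT => ie.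
  have [s sx] : exists s : 'I_(d i), s != x i.
    have [s0|s0] := eqVneq (Ordinal (d_gt0 i)) (x i); last by exists (Ordinal (d_gt0 i)).
    by exists (Ordinal (hd i)); rewrite -s0.
  have h1 : vx k x \in stage theta (vx k x) by rewrite inE same_stage_vx st_refl.
  have h2 : vx k (set1v x s) \in stage theta (vx k x).
    rewrite inE same_stage_vx hst; apply: ctx_agree_trans ex _.
    by rewrite agree_sym agree_set1v.
  have := h (vx k x); rewrite h1 => /forallP /(_ (vx k (set1v x s))).
  rewrite h2 !ffunE ik dfwith_in => /eqP[] e1.
  by rewrite e1 eqxx in sx.
split; first exact: (subsetP de).
have agr v : v \in stage theta (vx k x) -> v i = e i.
  rewrite he => /imsetP[z _ ->]; rewrite ffunE.
  by move: ie; rewrite inE; case: (e i).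
apply/'forall_implyP => v vS; apply/'forall_implyP => w wS.
by rewrite !agr.
Qed.

End TreeLabels.

(** * Balancedness as a rank-one condition, and its effect on the next level *)

Section Balanced.
Variables (R : realType) (p : nat) (d : 'I_p -> nat).
Variable hd : forall i : 'I_p, (2 <= d i)%N.
Variables (L : finType) (theta : pout d -> pout d -> L) (hT : cstree theta).
Implicit Types (x y z : outcome d) (k i : 'I_p) (c : pout d) (P Q : {set 'I_p})
  (a : L -> R) (n : nat) (X : {set L}).

Local Notation st := (st theta).
Local Notation lab := (lab theta).

Lemma path_prodE (T : comNzRingType) (a : L -> T) n x :
  path_prod theta a n x = \prod_(j < p | (n <= j)%N) a (lab j x).
Proof. by []. Qed.

Lemma path_prod_rec (T : comNzRingType) (a : L -> T) k x :
  path_prod theta a k x = a (lab k x) * path_prod theta a k.+1 x.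
Proof.
rewrite !path_prodE (bigD1 k) //=; congr (_ * _); apply: eq_bigl => j.
by rewrite ltn_neqAle andbC -val_eqE /= eq_sym.
Qed.

(* The interpolating polynomial of the level-n ancestor of x, evaluated at a. *)
Definition ival a n x := sum_agree (path_prod theta a n) (prefix_set p n) x.

Lemma ival_agree a n x y : agree (prefix_set p n) x y -> ival a n x = ival a n y.
Proof. exact: sum_agree_eq. Qed.

Lemma ival_rec a k x :
  ival a k x = \sum_(s : 'I_(d k)) a (lab k (set1v x s)) * ival a k.+1 (set1v x s).
Proof.
rewrite /ival (sum_agree_split1 _ _ (notin_prefix k)); apply: eq_bigr => s _.
rewrite -prefixS /sum_agree mulr_sumr; apply: eq_bigr => y xy.
by rewrite path_prod_rec (lab_agree theta xy).
Qed.

Lemma ival_gt0 a n x : (forall l, 0 < a l) -> 0 < ival a n x.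
Proof.
move=> h; have hp y : 0 < path_prod theta a n y by apply: prodr_gt0 => j _.
exact: sum_agree_gt0.
Qed.

Lemma ival_eval a n x :
  (interp_poly theta R n (vx n x)).@[fun i : 'I_#|L| => a (enum_val i)] = ival a n x.
Proof.
rewrite /interp_poly /ival /sum_agree rmorph_sum /=; apply: eq_bigr => y _.
rewrite /path_prod rmorph_prod /=; apply: eq_bigr => j _.
by rewrite mevalXU enum_rankK.
Qed.

Hypothesis hbal : balanced theta R.

Lemma ival_balanced a k x y (s r : 'I_(d k)) : st k x y ->
  ival a k.+1 (set1v x s) * ival a k.+1 (set1v y r)
  = ival a k.+1 (set1v x r) * ival a k.+1 (set1v y s).
Proof.
rewrite -same_stage_vx => xy.
have := hbal s r (vx_level k x) (vx_level k y) xy.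
move/(congr1 (meval (fun i : 'I_#|L| => a (enum_val i)))); rewrite !rmorphM /=.
by rewrite !ext_vx !ival_eval.
Qed.

(* The labels of the edges leaving level k are specialised to the indicator of
   X; by [lab_level] this does not affect the later levels. *)
Definition relabel k (X : {set L}) a l : R :=
  if [exists x : outcome d, lab k x == l] then (l \in X)%:R else a l.

Lemma ival_relabel k X a x : ival (relabel k X a) k.+1 x = ival a k.+1 x.
Proof.
apply: eq_bigr => y _; rewrite !path_prodE; apply: eq_bigr => j kj.
rewrite /relabel; case: ifPn => // /existsP[z /eqP /(lab_level hT) e].
by rewrite e ltnn in kj.
Qed.

(** The value of the interpolating polynomial with the labels in [X] switched on and the other
    labels of level [k] switched off. Choosing [X] extracts coefficients from an identity valid for
    all parameters. *)
Definition part k (X : {set L}) a x : R :=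
  \sum_(s : 'I_(d k) | lab k (set1v x s) \in X) ival a k.+1 (set1v x s).

Lemma ival_part k X a x : ival (relabel k X a) k x = part k X a x.
Proof.
rewrite ival_rec /part [RHS]big_mkcond /=; apply: eq_bigr => s _.
rewrite ival_relabel /relabel ifT; last by apply/existsP; exists (set1v x s).
by case: ifP; rewrite ?mul1r ?mul0r.
Qed.

Lemma part_gt0 k X a x : (forall l, 0 < a l) -> lab k x \in X -> 0 < part k X a x.
Proof.
move=> ha xX; rewrite /part (bigD1 (x k)) /=; last by rewrite set1v_id.
rewrite ltr_pwDl ?ival_gt0 //.
by apply: sumr_ge0 => s _; apply/ltW/ival_gt0.
Qed.

Lemma part_eq0 k x y a : ~~ st k x y -> part k (labels theta k y) a x = 0.
Proof.
move=> xy; rewrite /part big_pred0 // => s; apply/negbTE.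
rewrite (labels_st hT); apply: contra xy; apply: st_trans.
by rewrite st_sym; apply/st_agree/agree_set1v/notin_prefix.
Qed.

Lemma part_neq0 k x y X a : part k X a x != 0 ->
  (forall z, lab k z \in X -> st k z y) -> st k x y.
Proof.
move=> h hX; apply: contraNT h => xy; rewrite /part big_pred0 // => s.
apply/negbTE; apply: contra xy => /hX; apply: st_trans.
by rewrite st_sym; apply/st_agree/agree_set1v/notin_prefix.
Qed.

(** Arrange the values at the level-[n] vertices of the context in a matrix, rows indexed by the
    outcomes on [P] and columns by the remaining ones: all its 2x2 minors vanish, for every choice
    of parameters. This is the polynomial counterpart of an independence given [c]. *)
Definition exchange n P c := forall a x y, ctx_agree c x -> ctx_agree c y ->
  ival a n x * ival a n y = ival a n (mix P x y) * ival a n (mix P y x).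

Lemma exchange_part k P c X a x y : exchange k P c ->
  ctx_agree c x -> ctx_agree c y ->
  part k X a x * part k X a y = part k X a (mix P x y) * part k X a (mix P y x).
Proof. by move=> h hx hy; rewrite -!ival_part; apply: h. Qed.

(** With all parameters 1, a [part] is positive if the vertex has a label in [X] and zero otherwise,
    so the identity compares supports. Taking for [X] the labels of one stage or of both determines
    the stages of the two mixed outcomes up to order. *)
Lemma exchange_stage k P c x y : exchange k P c ->
  ctx_agree c x -> ctx_agree c y ->
  st k (mix P x y) y && st k (mix P y x) x || st k (mix P x y) x && st k (mix P y x) y.
Proof.
move=> h hx hy; pose a1 (l : L) : R := 1.
have a1_gt0 l : 0 < a1 l by apply: ltr01.
have hX X := exchange_part X a1 h hx hy.
have hl z : lab k z \in labels theta k z by rewrite labels_st // st_refl.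
have pos X z w : lab k z \in X -> lab k w \in X -> part k X a1 z * part k X a1 w != 0.
  by move=> zX wX; rewrite gt_eqF // mulr_gt0 // part_gt0.
move: (mix P x y) (mix P y x) hX => Z W hX.
have [xy|nxy] := boolP (st k x y).
  have := pos (labels theta k x) x y (hl x).
  rewrite labels_st // st_sym xy hX => /(_ isT).
  rewrite mulf_eq0 negb_or => /andP[hZ hW].
  have Zx : st k Z x by apply: part_neq0 hZ _ => z; rewrite labels_st.
  have Wx : st k W x by apply: part_neq0 hW _ => z; rewrite labels_st.
  by rewrite Wx (st_trans Zx xy).
have := pos (labels theta k x :|: labels theta k y) x y.
rewrite !inE !hl orbT hX => /(_ isT isT); rewrite mulf_eq0 negb_or => /andP[hZ hW].
have xory w : part k (labels theta k x :|: labels theta k y) a1 w != 0 ->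
    st k w x || st k w y.
  move=> hw; apply: contraNT hw; rewrite negb_or => /andP[wx wy].
  rewrite /part big_pred0 // => s; rewrite inE !labels_st //.
  have ws : st k w (set1v w s) by rewrite st_sym; apply/st_agree/agree_set1v/notin_prefix.
  apply/negbTE; rewrite negb_or.
  by apply/andP; split; [apply: contra wx|apply: contra wy]; apply: st_trans.
have bad v : part k (labels theta k v) a1 x * part k (labels theta k v) a1 y = 0 ->
    st k Z v -> ~~ st k W v.
  rewrite hX => e Zv; apply/negP => Wv.
  by have := @pos (labels theta k v) Z W; rewrite !labels_st // e eqxx => /(_ Zv Wv).
have nyx : ~~ st k y x by rewrite st_sym.
have := bad x; rewrite (part_eq0 _ nyx) mulr0 => /(_ erefl) badx.
have := bad y; rewrite (part_eq0 _ nxy) mul0r => /(_ erefl) bady.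
have [Zx|Zx] := boolP (st k Z x).
  have := xory W hW; rewrite (negbTE (badx Zx)) => /= ->; exact: orbT.
have := xory Z hZ; rewrite (negbTE Zx) /= => Zy.
by have := xory W hW; rewrite (negbTE (bady Zy)) orbF Zy => ->.
Qed.

Lemma mix_ctx P c x y : ctx_agree c x -> ctx_agree c y -> ctx_agree c (mix P x y).
Proof.
move=> /ctx_agreeP hx /ctx_agreeP hy; apply/ctx_agreeP => i ci.
by rewrite mixE; case: ifP => _; [apply: hy|apply: hx].
Qed.

(* In the context c, the stages of level k depend either only on the outcomes
   in P or only on the remaining ones. *)
Lemma exchange_dichotomy k P c : exchange k P c ->
  (forall x y, ctx_agree c x -> ctx_agree c y -> st k (mix P x y) y) \/
  (forall x y, ctx_agree c x -> ctx_agree c y -> st k (mix P x y) x).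
Proof.
move=> h; apply: contrapT => /not_orP[h1 h2].
apply: h1 => x1 y1 hx1 hy1; apply: contraT => n1; exfalso.
apply: h2 => x0 y0 hx0 hy0; apply: contraT => n0.
have D x y := @exchange_stage k P c x y h.
have M x y hx hy := @mix_ctx P c x y hx hy.
have mixx x y z : mix P x (mix P y z) = mix P x z.
  by apply/ffunP => i; rewrite !mixE; case: (i \in P).
have mixl x y z : mix P (mix P x y) z = mix P x z.
  by apply/ffunP => i; rewrite !mixE; case: (i \in P).
(* The failure [n0] makes the stage of [x0] insensitive to coordinates outside [P], and [n1] makes
   that of [y1] insensitive to coordinates in [P]. The outcome equal to [x0] on [P] and to [y1]
   elsewhere puts [x0] and [y1] in one stage, which contradicts [n1]. *)
have f1 z : ctx_agree c z -> st k (mix P z x0) x0.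
  move=> hz; have := D x0 (mix P z y0) hx0 (M _ _ hz hy0).
  by rewrite mixx mixl (negbTE n0) /= orbF => /andP[].
have f2 z : ctx_agree c z -> st k (mix P y1 z) y1 && st k (mix P x1 y1) (mix P x1 z).
  move=> hz; have := D y1 (mix P x1 z) hy1 (M _ _ hx1 hz).
  by rewrite mixx mixl (negbTE n1) andbF.
have /andP[e1 e2] := f2 x0 hx0.
have e3 := f1 y1 hy1; have e4 := f1 x1 hx1.
case/negP: n1; apply: st_trans e2 _; apply: st_trans e4 _.
by apply: st_trans e1; rewrite st_sym.
Qed.

Lemma mixS k P x y : k \notin P -> mix (k |: P) x y = set1v (mix P x y) (y k).
Proof.
move=> kP; apply/ffunP => i; rewrite mixE !inE.
have [->|ik] := eqVneq i k; first by rewrite set1v_in.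
by rewrite set1v_out // mixE.
Qed.

Lemma part1 k a x (s : 'I_(d k)) z : st k x z ->
  part k [set lab k (set1v z s)] a x = ival a k.+1 (set1v x s).
Proof.
move=> xz; rewrite /part (big_pred1 s) // => r.
rewrite inE lab_eq // !set1v_in; rewrite (st_trans _ (st_trans xz _)) //.
  exact/st_agree/agree_set1v/notin_prefix.
by rewrite st_sym; apply/st_agree/agree_set1v/notin_prefix.
Qed.

Lemma part2 k a x (s r : 'I_(d k)) z : st k x z -> s != r ->
  part k [set lab k (set1v z s); lab k (set1v z r)] a x
  = ival a k.+1 (set1v x s) + ival a k.+1 (set1v x r).
Proof.
move=> xz sr.
have e (q t : 'I_(d k)) : (lab k (set1v x q) == lab k (set1v z t)) = (q == t).
  rewrite lab_eq // !set1v_in (st_trans _ (st_trans xz _)) //.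
    exact/st_agree/agree_set1v/notin_prefix.
  by rewrite st_sym; apply/st_agree/agree_set1v/notin_prefix.
rewrite /part (bigD1 s) /=; last by rewrite !inE e eqxx.
congr (_ + _).
rewrite (big_pred1 r) // => q; rewrite !inE !e.
have [->|] := eqVneq q s; first by rewrite (negbTE sr).
by rewrite andbT.
Qed.


(** [X] consists of the labels of the edges that [x] and [y] follow. In different stages, each of
    the four vertices meets [X] in a single label and the identity can be read off. In a common
    stage, singletons cancel the diagonal products of the two-label identity, and balancedness
    equates the two mixed products on each side, leaving twice the claim. *)
Lemma exchange_grow k P c : k \notin P -> k \notin dom c -> exchange k P c ->
  (forall x y, ctx_agree c x -> ctx_agree c y -> st k (mix P x y) y) ->
  exchange k.+1 (k |: P) c.
Proof.
move=> kP kc h hP a x y hx hy; rewrite !mixS //.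
have Zy := hP x y hx hy; have Wx := hP y x hy hx.
have E X := exchange_part X a h hx hy.
move: (mix P x y) (mix P y x) Zy Wx E => Z W Zy Wx E.
rewrite -[in LHS](set1v_id x k) -[in LHS](set1v_id y k).
move: (x k) (y k) => s r.
have e1 v w (q : 'I_(d k)) : st k v w ->
    part k [set lab k (set1v w q)] a v = ival a k.+1 (set1v v q).
  exact: part1.
have [xy|nxy] := boolP (st k x y).
  have yx : st k y x by rewrite st_sym.
  have Zx := st_trans Zy yx.
  have diag (q : 'I_(d k)) : ival a k.+1 (set1v x q) * ival a k.+1 (set1v y q) =
      ival a k.+1 (set1v Z q) * ival a k.+1 (set1v W q).
    by have := E [set lab k (set1v x q)]; rewrite !e1 ?st_refl.
  have [->|sr] := eqVneq s r; first exact: diag.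
  have := E [set lab k (set1v x s); lab k (set1v x r)].
  rewrite !part2 ?st_refl //.
  have := ival_balanced a s r xy.
  have ZW : st k Z W by apply: st_trans Zx _; rewrite st_sym.
  have := ival_balanced a s r ZW.
  have := diag s; have := diag r.
  move: (ival _ _ _) (ival _ _ _) (ival _ _ _) (ival _ _ _).
  move: (ival _ _ _) (ival _ _ _) (ival _ _ _) (ival _ _ _).
  move=> a1 a2 a3 a4 a5 a6 a7 a8; nra.
have := E [set lab k (set1v x s); lab k (set1v y r)].
have e2 v w w' (q q' : 'I_(d k)) : st k v w -> ~~ st k v w' ->
    part k [set lab k (set1v w q); lab k (set1v w' q')] a v =
    ival a k.+1 (set1v v q).
  move=> vw nvw; rewrite -(e1 v w q vw); apply: eq_bigl => t.
  rewrite !inE; case: eqP => //= _; apply/negbTE; rewrite lab_eq // negb_and.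
  apply/orP; left; apply: contra nvw => h'.
  have ag u (q0 : 'I_(d k)) : st k (set1v u q0) u.
    exact/st_agree/agree_set1v/notin_prefix.
  apply: st_trans (st_trans _ h') (ag _ _).
  by rewrite st_sym.
have nyx : ~~ st k y x by rewrite st_sym.
have nZx : ~~ st k Z x.
  by apply: contra nyx; apply: st_trans; rewrite st_sym.
have nWy : ~~ st k W y.
  by apply: contra nxy; apply: st_trans; rewrite st_sym.
rewrite e2 ?st_refl // (e2 W) //.
rewrite [in X in _ * X = _]setUC [in X in _ = X * _]setUC.
by rewrite !e2 ?st_refl.
Qed.

Lemma exchange_agree n P Q c : (forall x y, ctx_agree c x -> ctx_agree c y ->
  agree (prefix_set p n) (mix P x y) (mix Q y x)) -> exchange n P c ->
  exchange n Q c.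
Proof.
move=> hm h a x y hx hy; rewrite h // mulrC.
by rewrite (ival_agree _ (hm x y hx hy)) (ival_agree _ (hm y x hy hx)).
Qed.

Lemma exchange_swap n P Q c : pairwise_disjoint [:: P; Q; dom c] ->
  P :|: Q :|: dom c = prefix_set p n -> exchange n P c -> exchange n Q c.
Proof.
rewrite pairwise_disjoint3 => /and3P[PQ _ _] hn; apply: exchange_agree.
move=> x y hx hy; apply/agreeP => i; rewrite -hn !mixE !inE.
case: ifP => [iP _|_ /= ]; first by rewrite (disjointFr PQ iP).
case: ifP => //= _ ic; move/agreeP: (ctx_agree_agree hx hy) => -> //.
by rewrite inE.
Qed.

End Balanced.

(** * Growing a stage statement to all variables, and minimal contexts *)

Section Growth.
Variables (R : realType) (p : nat) (d : 'I_p -> nat).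
Variable hd : forall i : 'I_p, (2 <= d i)%N.
Variables (L : finType) (theta : pout d -> pout d -> L) (hT : cstree theta).
Hypothesis hbal : balanced theta R.
Implicit Types (x y z : outcome d) (k i : 'I_p) (c e : pout d)
  (P Q T : {set 'I_p}) (n : nat).

Local Notation st := (st theta).
Local Notation exchange := (exchange R theta).

Definition is_stage_ctx k x e := [/\ dom e \subset prefix_set p k,
  ctx_agree e x & forall y, st k x y = ctx_agree e y].

Lemma stage_stmt_ex k x : exists2 e, is_stage_ctx k x e &
  stage_statement theta (Csi [set k] (prefix_set p k :\: dom e) set0 e).
Proof.
have [e [de ex he hc]] := stage_ctx hd hT k x; exists e => //.
exists k, (vx k x); split; first exact: vx_level.
rewrite /= hc /vx restr_restr (setIidPl de).
by move/eqP: ex => ->.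
Qed.

Lemma stage_stmt_inv q : stage_statement theta q -> exists k x e,
  is_stage_ctx k x e /\ q = Csi [set k] (prefix_set p k :\: dom e) set0 e.
Proof.
case=> k [v [/(level_vx hd)[x ->] /= ->]].
have [e [de ex he ->]] := stage_ctx hd hT k x; exists k, x, e; split=> //.
rewrite /vx restr_restr (setIidPl de).
by move/eqP: ex => ->.
Qed.

Lemma other_value i (s : 'I_(d i)) : exists r : 'I_(d i), r != s.
Proof.
have [s0|s0] := eqVneq (Ordinal (d_gt0 hd i)) s; last by exists (Ordinal (d_gt0 hd i)).
by exists (Ordinal (hd i)); rewrite -s0.
Qed.

(** Once the values on [P] are fixed, changing a coordinate in [Q] keeps the stage, so the context
    of the stage avoids [Q]. Weak union and specialization turn the stage statement into one for
    these values, and absorption collects all values on [P]. *)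
Lemma stage_split k P Q c : pairwise_disjoint [:: P; Q; dom c] ->
  P :|: Q :|: dom c = prefix_set p k ->
  (forall x y, ctx_agree c x -> ctx_agree c y -> st k (mix P x y) y) ->
  J_tree theta (Csi [set k] Q P c).
Proof.
move=> dj hk hP; rewrite -(set0U P).
have kpre := notin_prefix k.
have kd : [disjoint [set k] & prefix_set p k] by rewrite disjoints1.
apply: csi_absorption; first by set_solve.
move=> xP; rewrite inE => /eqP dP.
have [x hx] := ctx_agree_ex (d_gt0 hd) (merge xP c).
have Px := ctx_agree_mergel hx.
have {hx} cx : ctx_agree c x.
  by apply: ctx_agree_merger hx; rewrite dP; set_solve.
have [e [de ex he] hst] := stage_stmt_ex k x.
have eQ : [disjoint dom e & Q].
  rewrite disjoints_subset; apply/subsetP => i ie; rewrite inE; apply/negP => iQ.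
  have [iP ic] : i \notin P /\ i \notin dom c.
    move: dj; rewrite pairwise_disjoint3 => /and3P[PQ _ Qc].
    by rewrite (disjointFl PQ iQ) (disjointFr Qc iQ).
  have [s sx] := other_value (x i).
  have cy : ctx_agree c (set1v x s).
    by apply: ctx_agree_trans cx _; rewrite agree_sym agree_set1v.
  have := hP x (set1v x s) cx cy.
  have -> : mix P x (set1v x s) = x.
    apply/ffunP => j; rewrite mixE; case: ifP => // jP.
    by rewrite set1v_out //; apply: contraNneq iP => <-.
  rewrite he => /ctx_agreeP /(_ i); move/ctx_agreeP/(_ i): ex.
  move: ie; rewrite inE => ie /(_ ie) -> /(_ isT) [/eqP].
  by rewrite set1v_in eq_sym (negbTE sx).
pose D := (P :|: dom c) :\: dom e.
have hs : J_tree theta (Csi [set k] (Q :|: D) set0 e).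
  have -> : Q :|: D = prefix_set p k :\: dom e by rewrite /D; clear -hk eQ; set_solve.
  exact: csi_base.
have {}hs : J_tree theta (Csi [set k] Q (set0 :|: D) e).
  by apply: csi_weak_union hs; rewrite /D; clear dP; set_solve.
have := @csi_specialization _ _ _ _ _ _ D _ (restr D (full x)) _ _ _ hs.
rewrite set0U setDv.
have -> : merge (restr D (full x)) e = merge xP c.
  move/eqP: (ex) => <-; move/eqP: (cx) => <-; move/eqP: (Px) => <-; rewrite dP.
  rewrite !merge_restr; congr (restr _ _).
  by rewrite /D; clear -hk eQ de; set_solve.
apply; last by rewrite inE dom_restr_full.
  by rewrite /D; clear dP; set_solve.
exact: subxx.
Qed.

(* The induction hypothesis of the growth argument: below level n, the context
   c splits the variables into P and Q, on the level of J(T) as well as on that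
   of the interpolating polynomials. *)
Definition splits n P Q c := [/\ pairwise_disjoint [:: P; Q; dom c],
  P :|: Q :|: dom c = prefix_set p n, J_tree theta (Csi P Q set0 c)
  & exchange n P c].

Lemma split_grow_side k P Q c : splits k P Q c ->
  (forall x y, ctx_agree c x -> ctx_agree c y -> st k (mix P x y) y) ->
  splits k.+1 (k |: P) Q c.
Proof.
case=> dj hk hJ hE hP.
have kpre := notin_prefix k.
have kd : [disjoint [set k] & prefix_set p k] by rewrite disjoints1.
have kU : k \notin P :|: Q :|: dom c by rewrite hk.
split.
- by set_solve.
- by rewrite -setUA -setUA setUA -!setUA prefixS -hk -!setUA.
- apply: csi_symmetry; first by set_solve.
  apply: csi_contraction; first by set_solve.
    apply: csi_symmetry; first by set_solve.
    by rewrite set0U; apply: stage_split.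
  by apply: csi_symmetry => //; set_solve.
- move: kU; rewrite !in_setU !negb_or => /andP[/andP[kP kQ] kc].
  by apply: exchange_grow.
Qed.

Lemma splits_sym n P Q c : splits n P Q c -> splits n Q P c.
Proof.
case=> dj hk hJ hE; split.
- by clear -dj; set_solve.
- by rewrite (setUC Q).
- by apply: csi_symmetry => //; clear -dj; set_solve.
- exact: exchange_swap dj hk hE.
Qed.

Lemma split_grow k P Q c : splits k P Q c ->
  splits k.+1 (k |: P) Q c \/ splits k.+1 P (k |: Q) c.
Proof.
move=> hs; case: (hs) => dj hk _ hE.
have [hP|hP] := exchange_dichotomy hT hE; first by left; apply: split_grow_side.
right; apply/splits_sym/split_grow_side; first exact: splits_sym.
move=> x y hx hy; apply: st_trans (hP y x hy hx); apply: st_agree.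
apply/agreeP => i; rewrite -hk !mixE !inE.
move: dj; rewrite pairwise_disjoint3 => /and3P[PQ _ _].
case: ifP => [iQ _|_]; first by rewrite (disjointFl PQ iQ).
case: ifP => //= iP ic.
by move/agreeP: (ctx_agree_agree hx hy) => -> //; rewrite inE.
Qed.

(** The start of the growth: the vertices in the context [e] form one stage, and for [P = [set k]]
    the [exchange] identity is balancedness itself. *)
Lemma stage_splits k x e : is_stage_ctx k x e ->
  J_tree theta (Csi [set k] (prefix_set p k :\: dom e) set0 e) ->
  splits k.+1 [set k] (prefix_set p k :\: dom e) e.
Proof.
case=> de ex he hJ.
have kd : [disjoint [set k] & prefix_set p k] by rewrite disjoints1 notin_prefix.
split=> //; first by set_solve.
  by rewrite prefixS; clear -de; set_solve.
move=> a y z hy hz; rewrite -{1}(set1v_id y k) -{1}(set1v_id z k).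
rewrite ival_balanced //; last first.
  by apply: (@st_trans _ _ _ _ _ _ x); rewrite ?[st k y x]st_sym he.
have e1 (u v : outcome d) : mix [set k] u v = set1v u (v k).
  apply/ffunP => i; rewrite mixE inE; case: eqVneq => [->|ik].
    by rewrite set1v_in.
  by rewrite set1v_out.
by rewrite !e1.
Qed.

Lemma stage_split_full k x e : is_stage_ctx k x e ->
  J_tree theta (Csi [set k] (prefix_set p k :\: dom e) set0 e) ->
  exists P Q, [/\ splits p P Q e, k \in P, prefix_set p k :\: dom e \subset Q
    & forall u, u \in P -> (k <= u)%N].
Proof.
move=> hk hJ; have hs := stage_splits hk hJ.
suff main m : (k.+1 + m <= p)%N -> exists P Q, [/\ splits (k.+1 + m) P Q e, k \in P,
    prefix_set p k :\: dom e \subset Q & forall u, u \in P -> (k <= u)%N].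
  have := main (p - k.+1)%N; rewrite subnKC //; exact.
elim: m => [_|m IH].
  rewrite addn0; exists [set k], (prefix_set p k :\: dom e).
  by split=> //; [rewrite inE|move=> u; rewrite inE => /eqP ->].
rewrite addnS => hm; have [P [Q [hPQ kP hQ hP]]] := IH (ltnW hm).
have [hg|hg] := split_grow (k := Ordinal hm) hPQ.
  exists (Ordinal hm |: P), Q; split=> //; first by rewrite inE kP orbT.
  move=> u; rewrite !inE => /orP[/eqP ->|/hP //] /=.
  by rewrite addSn leqW ?leq_addr.
exists P, (Ordinal hm |: Q); split=> //.
exact: subset_trans hQ (subsetUr _ _).
Qed.

Lemma minimal_context P Q c : P != set0 -> Q != set0 ->
  J_tree theta (Csi P Q set0 c) -> exists T, [/\ T \subset dom c,
    J_tree theta (Csi P Q T (restr (dom c :\: T) c))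
  & min_context theta (restr (dom c :\: T) c)].
Proof.
move=> P0 Q0 hJ.
pose good := [pred T : {set 'I_p} | (T \subset dom c) &&
  `[< J_tree theta (Csi P Q T (restr (dom c :\: T) c)) >]].
have g0 : good set0.
  by rewrite /= sub0set setD0 restr_dom; apply/asboolP.
have [T /maxsetP[/andP[Tc /asboolP hT'] hmax] _] := maxset_exists g0.
exists T; split=> //; exists P, Q, T; split=> // T'; rewrite dom_restr => T'c T'0 hJ'.
have T'c' : T' \subset dom c by apply: subset_trans T'c (subsetIr _ _).
have dT : [disjoint T & T'] by clear -T'c; set_solve.
have e : T :|: T' = T.
  apply: hmax; last exact: subsetUl.
  apply/andP; split; first by rewrite subUset Tc.
  apply/asboolP; move: hJ'; rewrite restr_restr.
  have -> // : ((dom c :\: T) :&: dom c :\: T') :&: (dom c :\: T) = dom c :\: (T :|: T').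
  by clear; set_solve.
case/set0Pn: T'0 => i iT'; have : i \in T by rewrite -e inE iT' orbT.
by rewrite (disjointFl dT iT').
Qed.

End Growth.

(** * Recovering the stage statements from the moralized graphs *)

Section Family.
Variables (R : realType) (p : nat) (d : 'I_p -> nat).
Variable hd : forall i : 'I_p, (2 <= d i)%N.
Variables (L : finType) (theta : pout d -> pout d -> L) (hT : cstree theta).
Hypothesis hbal : balanced theta R.
Variable G : pout d -> digraph p.
Hypothesis hG : forall c : pout d, min_context theta c ->
  min_context_dag (J_tree theta) c (G c).

Lemma family_stage (f : outcome d -> R) m : (forall x, 0 < f x) ->
  (forall c, min_context theta c -> forall A B S,
     dag_global (~: dom c) (iter m (@dm p) (G c)) A B S -> sat f (Csi A B S c)) ->
  forall q, stage_statement theta q -> ciq f q.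
Proof.
move=> f0 hf q hq; have [k [x [e [he eq]]]] := stage_stmt_inv hd hT hq.
have hJ : J_tree theta q by apply: csi_base.
rewrite eq in hJ *; have [P [Q [[dj hp hPQ _] kP hQ hP]]] := stage_split_full hd hT hbal he hJ.
case: (he) => de _ _.
move: (prefix_set p k :\: dom e) hQ hJ {eq hq} => B hQ hJ.
(* With [B] empty the stage statement is trivial; otherwise both sides are nonempty, as a minimal
   context demands. *)
have [->|B0] := eqVneq B set0.
  by move=> y _; rewrite /= !set0U setU0.
have Q0 : Q != set0 by apply: contraNneq B0 => e0; rewrite -subset0 -e0.
have P0 : P != set0 by apply/set0Pn; exists k.
have [T [Te hJT hmin]] := minimal_context P0 Q0 hPQ.
set c := restr (dom e :\: T) e in hJT hmin.
have dc : dom c = dom e :\: T by rewrite dom_restr; clear; set_solve.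
have preT : prefix_set p p = setT by apply/setP => i; rewrite !inE ltn_ord.
have hV : P :|: Q :|: T = ~: dom c.
  rewrite dc -setTD -preT -hp; clear -Te dj; set_solve.
have TP t u : t \in T -> u \in P -> (t < u)%N.
  move=> tT /hP ku; apply: leq_trans ku; have := subsetP de t (subsetP Te t tT).
  by rewrite inE.
have dj' : pairwise_disjoint [:: P; Q; T; dom c].
  by rewrite dc; clear -dj Te; set_solve.
have hdag := hG hmin; have [G_dag _ _] := hdag.
have nc := min_dag_no_cross hdag dj' hV TP hJT.
have dj3 : pairwise_disjoint [:: P; Q; T] by clear -dj'; set_solve.
have glob : dag_global (~: dom c) (iter m (@dm p) (G c)) P Q T.
  split=> //.
  - by rewrite -hV -setUA subsetUl.
  - by rewrite -hV; apply: subset_trans (subsetUr P Q) (subsetUl _ _).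
  - by rewrite -hV subsetUr.
  - apply: (@no_cross_dsep _ (~: dom c)) => //; first exact: iter_dm_ordered.
    by apply: iter_dm_no_cross TP nc => //; rewrite hV.
have hci : ciq f (Csi P Q T c).
  by apply/(sat_ciP f0) => //; [exact: d_gt0|exact: hf].
(* Soundness is used with this single statement as base; the stage statement is derived from it by
   the axioms. *)
apply: (@csi_sound _ _ _ f f0 (fun q => q = Csi P Q T c)) => [_ ->//|].
have me : merge (restr T e) c = e.
  apply/ffunP => i; rewrite !ffunE !inE.
  by case: (i \in T); case: (e i).
have h1 : csi_derivable (fun q => q = Csi P Q T c) (Csi P Q set0 e).
  rewrite -me -(setDv T); apply: csi_specialization => //; last exact: csi_base.
  by rewrite inE dom_restr; apply/eqP/setIidPl.
have kP' : [set k] \subset P by rewrite sub1set.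
apply: Jc_subset hQ _ _; first by clear -dj kP'; set_solve.
apply: Jc_symmetry; first by clear -dj kP'; set_solve.
apply: Jc_subset kP' _ _; first by clear -dj; set_solve.
by apply: Jc_symmetry => //; clear -dj; set_solve.
Qed.

End Family.

(** * The model as the set of positive distributions satisfying the stage statements *)

Section Model.
Variables (R : realType) (p : nat) (d : 'I_p -> nat).
Variable hd : forall i : 'I_p, (2 <= d i)%N.
Variables (L : finType) (theta : pout d -> pout d -> L) (hT : cstree theta).
Implicit Types (x y z : outcome d) (k i : 'I_p) (c e : pout d)
  (P Q T : {set 'I_p}) (n : nat) (f : outcome d -> R).

Local Notation st := (st theta).
Local Notation lab := (lab theta).

Lemma prefix_full : prefix_set p p = setT.
Proof. by apply/setP => i; rewrite !inE ltn_ord. Qed.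

Lemma prefix0 : prefix_set p 0 = set0.
Proof. by apply/setP => i; rewrite !inE. Qed.

Lemma sum_out (a : L -> R) k x :
  \sum_(w in out (vx k x)) a (theta (vx k x) w)
  = \sum_(s : 'I_(d k)) a (lab k (set1v x s)).
Proof.
rewrite out_vx big_imset /=.
  by apply: eq_bigr => s _; rewrite /lab vx_set1v.
move=> s r _ _ /(congr1 (fun g : pout d => g k)).
by rewrite !ffunE inE ltnSn !dfwith_in => -[].
Qed.

Lemma ci_stageP f k x e : (forall y, 0 < f y) -> is_stage_ctx theta k x e ->
  ciq f (Csi [set k] (prefix_set p k :\: dom e) set0 e) <->
  (forall y, ctx_agree e y ->
     sum_agree f (prefix_set p k.+1) y * sum_agree f (dom e) y
     = sum_agree f (k |: dom e) y * sum_agree f (prefix_set p k) y).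
Proof.
move=> f0 [de _ _]; rewrite /ciq /ci /=.
have -> : [set k] :|: (prefix_set p k :\: dom e) :|: set0 :|: dom e = prefix_set p k.+1.
  by rewrite prefixS; clear -de; set_solve.
have -> : prefix_set p k :\: dom e :|: set0 :|: dom e = prefix_set p k.
  by clear -de; set_solve.
by rewrite set0U setU0.
Qed.

(** The conditional of the variable [k] given its predecessors is the parameter of the edge
    followed, which within a stage depends on the value of [k] alone; summing over the predecessors
    outside the context gives the statement. *)
Lemma model_stage f : model theta f ->
  forall q, stage_statement theta q -> ciq f q.
Proof.
case=> -[f0 _] [a [_ asum fa]] q /(stage_stmt_inv hd hT)[k [x0 [e [he ->]]]].
apply/(ci_stageP f0 he) => x ex; case: he => de _ hst.
(* The parameters below any vertex sum to one. The recursion runs from the leaves upwards, hence the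
   level [p - m]. *)
have ival1 m y : (m <= p)%N -> ival theta a (p - m) y = 1.
  elim: m y => [|m IH] y mp.
    rewrite subn0 /ival prefix_full sum_agreeT path_prodE big_pred0 // => j.
    by rewrite leqNgt ltn_ord.
  have lt : (p - m.+1 < p)%N by rewrite ltn_subrL /= (leq_ltn_trans _ mp).
  have := ival_rec theta a (Ordinal lt) y => /= ->.
  have e1 : (p - m.+1).+1 = (p - m)%N by rewrite subnSK.
  under eq_bigr do rewrite e1 (IH _ (ltnW mp)) mulr1.
  by rewrite -sum_out asum ?nonleaf_vx.
have prE n y : (n <= p)%N ->
    sum_agree f (prefix_set p n) y = \prod_(j < p | (j < n)%N) a (lab j y).
  move=> np; have := ival1 (p - n)%N y (leq_subr _ _); rewrite subKn // => iv.
  rewrite -[RHS]mulr1 -[X in _ = _ * X]iv /ival mulr_sumr; apply: eq_bigr => z zy.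
  rewrite fa !path_prodE [LHS](bigID (fun j : 'I_p => (j < n)%N)) /=; congr (_ * _).
    apply: eq_bigr => j jn; congr (a _); apply: lab_agree.
    apply: agreeS zy; apply/subsetP => i; rewrite !inE ltnS => ij.
    exact: leq_ltn_trans ij jn.
  by apply: eq_bigl => j; rewrite -leqNgt.
have prS y : sum_agree f (prefix_set p k.+1) y
    = a (lab k y) * sum_agree f (prefix_set p k) y.
  rewrite !prE ?ltn_ord ?(ltnW (ltn_ord k)) // (bigD1 k) //=; congr (_ * _).
  by apply: eq_bigl => j; rewrite ltnS ltn_neqAle andbC.
pose B := prefix_set p k :\: dom e.
have dB : [disjoint dom e & B] by rewrite /B; clear; set_solve.
have kd : [disjoint [set k] & prefix_set p k] by rewrite disjoints1 notin_prefix.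
have kB : [disjoint k |: dom e & B] by rewrite /B; clear -dB kd; set_solve.
rewrite (sum_agree_split _ _ dB) (sum_agree_split _ _ kB).
rewrite mulr_sumr mulr_suml; apply: eq_bigr => z zx.
have -> : dom e :|: B = prefix_set p k by rewrite /B; clear -de; set_solve.
have -> : k |: dom e :|: B = prefix_set p k.+1.
  by rewrite prefixS /B; clear -de; set_solve.
rewrite !prS; have -> : lab k z = lab k x; last by ring.
have ez : ctx_agree e z.
  apply: ctx_agree_trans ex _; rewrite agree_sym; apply: agreeS zx.
  by rewrite -disjoints_subset.
apply/eqP; rewrite lab_eq //; apply/andP; split.
  have z0 : st k z x0 by rewrite st_sym hst.
  by apply: st_trans z0 _; rewrite hst.
by move/agreeP: zx => -> //; rewrite inE /B !inE ltnn andbF.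
Qed.

(** The conditional probabilities of [f] serve as parameters, and their product along a path
    telescopes. The stage statements make them functions of the labels. *)
Lemma stage_model f : open_simplex f ->
  (forall q, stage_statement theta q -> ciq f q) -> model theta f.
Proof.
move=> hf hq; split=> //; case: hf => f0 f1.
pose pr := sum_agree f; have pr0 A x : 0 < pr A x by apply: sum_agree_gt0.
have prn A x : pr A x != 0 by rewrite gt_eqF.
pose cp k x := pr (prefix_set p k.+1) x / pr (prefix_set p k) x.
have cp_lab k x y : lab k x = lab k y -> cp k x = cp k y.
  move/eqP; rewrite lab_eq // => /andP[xy /eqP ek].
  have [e he /hq hs] := stage_stmt_ex hd hT k x.
  have {}hs := (ci_stageP f0 he).1 hs; case: (he) => de ex hst.
  have ey : ctx_agree e y by rewrite -hst.
  have cpE z : ctx_agree e z -> cp k z = pr (k |: dom e) z / pr (dom e) z.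
    by move=> ez; apply/eqP; rewrite eqr_div // hs.
  have exy : agree (dom e) x y by apply: ctx_agree_agree ex ey.
  rewrite !cpE // /pr (sum_agree_eq _ exy); congr (_ / _); apply: sum_agree_eq.
  rewrite agreeU exy andbT; apply/agreeP => i; rewrite inE => /eqP ->.
  exact: ek.
(* Any edge carrying the label may be picked, by [cp_lab]; the value 0 goes to labels that no edge
   carries. *)
pose a l : R := if [pick kx : 'I_p * outcome d | lab kx.1 kx.2 == l] is Some kx
  then cp kx.1 kx.2 else 0.
have aE k x : a (lab k x) = cp k x.
  rewrite /a; case: pickP => [[j y] /= /eqP e|/(_ (k, x))]; last by rewrite eqxx.
  by have ej := lab_level hT e; subst j; apply: cp_lab.
have prS k x : pr (prefix_set p k) x
    = \sum_(s : 'I_(d k)) pr (prefix_set p k.+1) (set1v x s).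
  by rewrite /pr (sum_agree_split1 _ _ (notin_prefix k)) -prefixS.
exists a; split.
- move=> v w /existsP[k /andP[/(level_vx hd)[x ->] /existsP[s /eqP ->]]].
  rewrite labE aE /cp divr_gt0 ?pr0 //= ltr_pdivrMr // mul1r.
  (* A second value of positive probability keeps the parameter strictly below 1. *)
  have [r rs] := other_value hd s.
  rewrite prS (bigD1 s) //= (bigD1 r) //=.
  have ss (t : 'I_(d k)) : set1v (set1v x s) t = set1v x t.
    apply/ffunP => i; have [->|ik] := eqVneq i k; first by rewrite !set1v_in.
    by rewrite !set1v_out.
  rewrite !ss ltrDl ltr_pwDl // sumr_ge0 // => t _.
  exact: ltW.
- move=> v /existsP[k /(level_vx hd)[x ->]]; rewrite sum_out.
  under eq_bigr do rewrite aE.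
  have e (s : 'I_(d k)) : cp k (set1v x s) =
      pr (prefix_set p k.+1) (set1v x s) / pr (prefix_set p k) x.
    rewrite /cp; congr (_ / _); apply: sum_agree_eq.
    exact/agree_set1v/notin_prefix.
  under eq_bigr do rewrite e.
  by rewrite -mulr_suml -prS divff.
move=> x; rewrite path_prodE; under eq_bigr do rewrite aE.
rewrite /cp -(big_mkord predT (fun n => pr (prefix_set p n.+1) x / pr (prefix_set p n) x)).
have [p0|p_gt0] := posnP p.
  have e0 : [set: 'I_p] = set0.
    by apply/setP => i; have := ltn_ord i; rewrite {2}p0.
  by rewrite big_geq ?p0 // -(sum_agreeT f x) e0 sum_agree0.
rewrite telescope_prodf //.
by rewrite prefix_full prefix0 /pr sum_agreeT sum_agree0 f1 divr1.
Qed.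

Variable G : pout d -> digraph p.
Hypothesis hG : forall c : pout d, min_context theta c ->
  min_context_dag (J_tree theta) c (G c).

Lemma model_family f m c A B S : model theta f -> min_context theta c ->
  dag_global (~: dom c) (iter m (@dm p) (G c)) A B S -> sat f (Csi A B S c).
Proof.
move=> hf hc hs; case: (hf) => -[f0 _] _; have [G_dag himap _] := hG hc.
have [AV BV SV dj sep] := hs.
have [_ _ _ hJ] : J_context (J_tree theta) c A B S.
  apply: himap; split=> //; apply: dsepS sep; first exact: iter_dm_sub.
  by have := iter_dm_ordered (m := m) G_dag; apply: ordered_increasing.
apply/(sat_ciP f0) => //; first exact: d_gt0.
  by rewrite /csi_valid /=; clear -AV BV SV dj; set_solve.
by apply: (csi_sound f0) hJ; apply: model_stage.
Qed.

Hypothesis hbal : balanced theta R.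

(** With [m] arbitrary, a single moralization and the ['C(p, 2)]-fold one are both instances. *)
Lemma family_model_implies m q : csi_valid q ->
  family_implies R (min_context theta) (fun c => iter m (@dm p) (G c)) q <->
  model_implies R theta q.
Proof.
move=> hq; split=> [h f hf|h f hf hfam].
  apply: h; first by case: hf.
  by move=> c hc A B S; apply: model_family.
by apply/h/stage_model => //; apply: family_stage hfam => //; case: hf.
Qed.

End Model.

Theorem theorem1p2 (R : realType) (p : nat) (d : 'I_p -> nat)
    (hd : forall i : 'I_p, (2 <= d i)%N)
    (L : finType) (theta : pout d -> pout d -> L)
    (hT : cstree theta) (hbal : balanced theta R)
    (G : pout d -> digraph p)
    (hG : forall c : pout d, min_context theta c ->
            min_context_dag (J_tree theta) c (G c)) :
  (forall q : csi d, csi_valid q ->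
     (family_implies R (min_context theta) (fun c => dm (G c)) q <->
      model_implies R theta q)) /\
  (forall c : pout d, min_context theta c -> perfect (per (G c))) /\
  (forall q : csi d, csi_valid q ->
     (family_implies R (min_context theta) (fun c => per (G c)) q <->
      model_implies R theta q)).
Proof.
split; first by move=> q; apply: (family_model_implies hd hT hG hbal 1).
split=> [c /hG[G_dag _ _]|q]; first exact: per_perfect G_dag.
exact: family_model_implies.
Qed.
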